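(* Let $n$ be a positive integer. Every Banach space $X$ of genus $n$ can be decomposed as $X\cong X_1\oplus X_2\oplus\cdots\oplus X_m$ for some positive integer $m$, where each $X_i$ is unconditionally primary.
   Context: Two sequences $(x_n)$, $(y_n)$ in Banach spaces are equivalent, $(x_n)\sim(y_n)$, if $Tx_n=y_n$ defines an isomorphism between their closed linear spans; they are permutatively equivalent if $(x_n)\sim(y_{\pi(n)})$ for some permutation $\pi$ of the index set. A Banach space has a unique normalized unconditional basis if it has a normalized unconditional basis and any two such bases are permutatively equivalent. A Banach space $X$ is of genus $n$ if $X$ and all its complemented subspaces with unconditional bases have a unique normalized unconditional basis, and there are, up to isomorphism, exactly $n$ different (infinite-dimensional) complemented subspaces of $X$ with unconditional bases ($X$ itself included in the count). For example, $\ell_1\oplus\ell_2$ is of genus 3. A Banach space $X$ is unconditionally primary if whenever $X\cong Y\oplus Z$ and $Y$, $Z$ have unconditional bases, then either $X\cong Y$ or $X\cong Z$. Here $\cong$ means linearly isomorphic. *)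

(* Defs.v *)
From HB Require Import structures.
From mathcomp Require Import all_boot all_order all_algebra.
From mathcomp Require Import all_classical all_reals all_analysis.
From mathcomp Require Import complex.

Set Implicit Arguments.
Unset Strict Implicit.
Unset Printing Implicit Defensive.

Import Order.TTheory GRing.Theory Num.Theory.
Import numFieldNormedType.Exports.

Local Open Scope classical_set_scope.
Local Open Scope ring_scope.

(* Banach spaces are real or complex; a norm over [R[i]] takes its values in the
   nonnegative reals of [R[i]]. *)
Variant scalars := RealScalars | ComplexScalars.

Definition scalar_field (R : realType) (s : scalars) : numFieldType :=
  match s with
  | RealScalars => R
  | ComplexScalars => R[i]
  end.

(* Subspaces are given as sets [S] of an ambient space, a whole space being
   [[set: V]]. *)
Section Isomorphism.
Context {K : numFieldType}.

(* Only the values of [T] on [S] matter. *)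
Definition isomorphism_on (V W : normedModType K) (S : set V) (S' : set W)
    (T : V -> W) : Prop :=
  [/\ (forall (a : K) (u v : V),
         S u -> S v -> T (a *: u + v) = a *: T u + T v),
      set_bij S S' T,
      (exists C : K, forall v, S v -> `|T v| <= C * `|v|) &
      (exists C : K, forall v, S v -> `|v| <= C * `|T v|)].

Definition isomorphic_on (V W : normedModType K) (S : set V) (S' : set W) :
    Prop :=
  exists T : V -> W, isomorphism_on S S' T.

Definition isomorphic (V W : normedModType K) : Prop :=
  isomorphic_on [set: V] [set: W].

End Isomorphism.

(* A sequence is a map [x : nat -> V] read on an index set [D]: either all of
   [nat], or [`I_k] for a finite sequence of length [k].  The values of [x]
   outside [D] are irrelevant.  Finite sequences are needed because
   finite-dimensional spaces have unconditional bases too. *)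
Definition index_set (D : set nat) : Prop :=
  D = [set: nat] \/ exists k : nat, D = `I_k.

Section Sequences.
Context {K : numFieldType}.

Definition partial_sum (V : normedModType K) (D : set nat) (a : nat -> K)
    (x : nat -> V) (m : nat) : V :=
  \sum_(i < m | (i : nat) \in D) a i *: x i.

Definition linear_span (V : normedModType K) (D : set nat) (x : nat -> V) :
    set V :=
  [set v | exists (m : nat) (a : nat -> K), v = partial_sum D a x m].

Definition closed_span (V : normedModType K) (D : set nat) (x : nat -> V) :
    set V :=
  closure (linear_span D x).

Definition equivalent (V W : normedModType K) (D : set nat) (x : nat -> V)
    (y : nat -> W) : Prop :=
  exists T : V -> W,
    isomorphism_on (closed_span D x) (closed_span D y) T /\
    (forall i, D i -> T (x i) = y i).

(* For index sets as above, a bijection from [D] onto [D'] exists only if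
   [D = D'], so that [p] is a permutation of the common index set. *)
Definition permutatively_equivalent (V W : normedModType K)
    (D : set nat) (x : nat -> V) (D' : set nat) (y : nat -> W) : Prop :=
  exists p : nat -> nat, set_bij D D' p /\ equivalent D x (y \o p).

Definition expands (V : normedModType K) (D : set nat) (x : nat -> V)
    (a : nat -> K) (v : V) : Prop :=
  partial_sum D a x m @[m --> \oo] --> v.

Definition schauder_basis (V : normedModType K) (S : set V) (D : set nat)
    (x : nat -> V) : Prop :=
  (forall i, D i -> S (x i)) /\
  (forall v, S v -> exists a : nat -> K,
     expands D x a v /\
     (forall b : nat -> K, expands D x b v -> forall i, D i -> b i = a i)).

Definition unconditional_basis (V : normedModType K) (S : set V) (D : set nat)
    (x : nat -> V) : Prop :=
  schauder_basis S D x /\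
  (forall (v : V) (a : nat -> K), S v -> expands D x a v ->
     forall p : nat -> nat, set_bij D D p -> expands D (x \o p) (a \o p) v).

Definition has_unconditional_basis (V : normedModType K) (S : set V) : Prop :=
  exists (D : set nat) (x : nat -> V),
    index_set D /\ unconditional_basis S D x.

Definition normalized_unconditional_basis (V : normedModType K) (S : set V)
    (D : set nat) (x : nat -> V) : Prop :=
  [/\ index_set D, unconditional_basis S D x & forall i, D i -> `|x i| = 1].

Definition unique_normalized_unconditional_basis (V : normedModType K)
    (S : set V) : Prop :=
  (exists (D : set nat) (x : nat -> V), normalized_unconditional_basis S D x) /\
  (forall (D D' : set nat) (x y : nat -> V),
     normalized_unconditional_basis S D x ->
     normalized_unconditional_basis S D' y ->
     permutatively_equivalent D x D' y).

Definition finite_dimensional (V : normedModType K) (S : set V) : Prop :=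
  exists (k : nat) (e : nat -> V), S `<=` linear_span `I_k e.

End Sequences.

Section Genus.
Context {K : numFieldType}.

Definition complemented_subspace (X : completeNormedModType K) (S : set X) :
    Prop :=
  exists P : {linear X -> X},
    [/\ continuous P, (forall v, P (P v) = P v) & range P = S].

Definition genus (n : nat) (X : completeNormedModType K) : Prop :=
  [/\ unique_normalized_unconditional_basis [set: X],
      (forall S : set X, complemented_subspace S -> has_unconditional_basis S ->
         unique_normalized_unconditional_basis S) &
      exists S_ : 'I_n -> set X,
        [/\ (forall i, [/\ complemented_subspace (S_ i),
                           has_unconditional_basis (S_ i) &
                           ~ finite_dimensional (S_ i)]),
            (forall i j, isomorphic_on (S_ i) (S_ j) -> i = j) &
            (forall S : set X, complemented_subspace S ->
               has_unconditional_basis S -> ~ finite_dimensional S ->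
               exists i, isomorphic_on S (S_ i))]].

Definition unconditionally_primary (X : completeNormedModType K) : Prop :=
  forall Y Z : completeNormedModType K,
    isomorphic X (Y * Z)%type ->
    has_unconditional_basis [set: Y] -> has_unconditional_basis [set: Z] ->
    isomorphic X Y \/ isomorphic X Z.

(* The sum of the [m.+1] spaces [X_ 0], ..., [X_ m], with the max norm. *)
Fixpoint direct_sum (X_ : nat -> completeNormedModType K) (m : nat) :
    normedModType K :=
  match m with
  | 0%N => X_ 0%N
  | k.+1 => (direct_sum X_ k * X_ k.+1)%type
  end.

End Genus.

(* Main.v *)
From HB Require Import structures.
Require Import Defs.
From mathcomp Require Import all_boot all_order all_algebra.
From mathcomp Require Import all_classical all_reals all_analysis.
From mathcomp Require Import complex.

Set Implicit Arguments.
Unset Strict Implicit.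
Unset Printing Implicit Defensive.

Import Order.TTheory GRing.Theory Num.Theory.
Import numFieldNormedType.Exports.

Local Open Scope classical_set_scope.
Local Open Scope ring_scope.

(** Why such an [X] is a finite sum of unconditionally primary spaces.

    If [X] is not unconditionally primary, it splits as [Y1 * Y2] with [Y1] and
    [Y2] having unconditional bases and neither isomorphic to [X].  Each factor
    is again (isomorphic to) a complemented subspace of [X], so it can be split
    further as long as it is not unconditionally primary.  The point is that
    this process stops.

    Attach to a space [Y] the finite set of those of the [n] isomorphism
    classes which contain [Y] or a summand [Z] in some [Y ~ Z * W], where [Z]
    and [W] have unconditional bases ([classes_below]).  It can only shrink when
    passing to a factor.  If it did not shrink strictly from an
    infinite-dimensional [Y] to its factor [Y1], it would still contain the
    class of [Y], that is [Y1 ~ Y * W] and hence [Y ~ Y * W * Y2]; a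
    Cantor-Bernstein argument ([absorption]) then gives [Y ~ Y * W ~ Y1], which
    was excluded.
    For a finite-dimensional [Y] the length of a basis decreases instead
    ([finite_decomposable]).

    The Cantor-Bernstein step is where uniqueness of bases enters.  Uniqueness
    turns an isomorphism [Y * W * Z ~ Y] into one, [T], which maps the union of
    bases of [Y], [W] and [Z] onto nonzero multiples of a basis [e] of [Y]
    ([bases_equivalent], [split_basis]).  With [in1 y = T (y, 0, 0)], the copies
    of [Z] in the images of [in1 ^ k] are then spanned by disjoint sets of
    basis vectors, and unconditionality makes the projections onto the first
    copies converge pointwise ([partial_proj_cvg]).  By uniform boundedness
    the limit [L] is a bounded projection; it satisfies [L (in1 y) = in1 (L y)],
    kills the copy of [W] and fixes the copy of [Z], and the map
    [y |-> in1 (L y) + (y - L y)], which shifts every copy of [Z] to the next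
    one, is an isomorphism of [Y] onto [T (Y * W * 0)] ([decomposition]).

    In this argument the scaling factors are harmless, so a basis of [Y] may be
    normalized with respect to any embedding of [Y] into [X].  Unconditional
    convergence enters in the form of convergence of the net of finite sums,
    to which it is equivalent ([rearranged_unordered_sum],
    [unordered_sum_rearranged]). *)

(** * Sequences and bounded operators *)

Section Sequences.
Context {K : numFieldType}.

Lemma cvg_epsP (V : normedModType K) (u : nat -> V) (l : V) :
  (u @ \oo --> l) <->
  (forall e : K, 0 < e -> exists N, forall n, (N <= n)%N -> `|l - u n| < e).
Proof.
split=> [/cvgrPdist_lt ul e /ul [N _ hN]|ul].
  by exists N => n Nn; exact: hN.
by apply/cvgrPdist_lt => e /ul [N hN]; exists N.
Qed.

Lemma cauchy_seq_cvg (V : completeNormedModType K) (u : nat -> V) :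
  (forall e : K, 0 < e -> exists N, forall n, (N <= n)%N -> `|u N - u n| < e) ->
  exists l : V, u @ \oo --> l.
Proof.
move=> uC; suff /cauchy_cvgP ul : cauchy (u @ \oo) by exists (lim (u @ \oo)).
apply: cauchy_exP => e /uC [N hN].
by exists (u N); exists N => // n /= Nn; rewrite -ball_normE /=; exact: hN.
Qed.

Lemma limit_norm_le (V : normedModType K) (u : nat -> V) (l a : V) (r : K) N :
  u @ \oo --> l -> (forall n, (N <= n)%N -> `|u n - a| <= r) -> `|l - a| <= r.
Proof.
move=> /cvg_epsP ul ur; apply/ler_addgt0Pr => e /ul [M hM].
have := hM _ (leq_maxl M N); have := ur _ (leq_maxr M N).
move: (maxn M N) => n h1 h2.
rewrite -(subrKA (u n)) addrC (le_trans (ler_normD _ _)) // lerD //.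
exact: ltW.
Qed.

End Sequences.

Section BoundedOperators.
Context {K : numFieldType}.
Implicit Types U V W : normedModType K.

(** A bound found over [R[i]] need not be real, so it cannot be multiplied
    through an inequality before it is replaced by a positive one. *)
Lemma positive_bound (V U W : normedModType K) (S : set V) (f : V -> U)
    (g : V -> W) (C : K) : (forall v, S v -> `|f v| <= C * `|g v|) ->
  exists D : K, 0 < D /\ forall v, S v -> `|f v| <= D * `|g v|.
Proof.
move=> hC; exists (`|C| + 1); split; first by rewrite ltr_wpDl.
move=> v /hC Cv; rewrite mulrDl mul1r ler_wpDr // -[X in _ * X]normr_id -normrM.
by rewrite [leRHS]ger0_norm // (le_trans _ Cv).
Qed.

Definition bounded_op V W (f : V -> W) : Prop :=
  (forall (a : K) u v, f (a *: u + v) = a *: f u + f v) /\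
  exists C : K, forall v, `|f v| <= C * `|v|.

Section Theory.
Context (V W : normedModType K) (f : V -> W) (fb : bounded_op f).

Lemma opD u v : f (u + v) = f u + f v.
Proof. by have := fb.1 1 u v; rewrite !scale1r. Qed.

Lemma op0 : f 0 = 0.
Proof. by apply: (@addIr _ (f 0)); rewrite -opD !add0r. Qed.

Lemma opZ a v : f (a *: v) = a *: f v.
Proof. by have := fb.1 a v 0; rewrite op0 !addr0. Qed.

Lemma opB u v : f (u - v) = f u - f v.
Proof. by rewrite opD -(scaleN1r v) opZ scaleN1r. Qed.

Lemma op_sum (I : Type) (s : seq I) (P : pred I) (F : I -> V) :
  f (\sum_(i <- s | P i) F i) = \sum_(i <- s | P i) f (F i).
Proof. by elim/big_ind2: _ => [|x1 x2 y1 y2 <- <-|//]; rewrite ?op0 ?opD. Qed.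

Lemma op_bound : exists C : K, 0 < C /\ forall v, `|f v| <= C * `|v|.
Proof.
have [_ [C hC]] := fb.
have [D [D0 hD]] := positive_bound (S := [set: V]) (fun v _ => hC v).
by exists D; split=> // v; exact: hD.
Qed.

Lemma op_cvg (u : nat -> V) l : u @ \oo --> l -> (f \o u) @ \oo --> f l.
Proof.
have [C [C0 hC]] := op_bound.
move=> /cvg_epsP ul; apply/cvg_epsP => e e0.
have /ul [N hN] : 0 < e / C by rewrite divr_gt0.
exists N => n /hN /= h; rewrite -opB (le_lt_trans (hC _)) //.
by rewrite -ltr_pdivlMl // mulrC.
Qed.

End Theory.

Lemma bop_id V : bounded_op (@id V).
Proof. by split=> //; exists 1 => v; rewrite mul1r. Qed.

Lemma bop_0 V W : bounded_op (fun _ : V => 0 : W).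
Proof.
by split=> [a u v|]; [rewrite scaler0 addr0|exists 0 => v; rewrite normr0 mul0r].
Qed.

Lemma bop_comp U V W (g : V -> W) (f : U -> V) :
  bounded_op g -> bounded_op f -> bounded_op (g \o f).
Proof.
move=> gb fb; split=> [a u v|]; first by rewrite /= fb.1 gb.1.
have [C [C0 hC]] := op_bound gb; have [D [D0 hD]] := op_bound fb.
exists (C * D) => v /=; rewrite (le_trans (hC _)) // -mulrA ler_pM2l //.
Qed.

Lemma bop_add V W (f g : V -> W) :
  bounded_op f -> bounded_op g -> bounded_op (fun v => f v + g v).
Proof.
move=> fb gb; split=> [a u v|]; first by rewrite fb.1 gb.1 scalerDr addrACA.
have [_ [C hC]] := fb; have [_ [D hD]] := gb.
exists (C + D) => v; rewrite (le_trans (ler_normD _ _)) // mulrDl.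
by rewrite lerD.
Qed.

Lemma bop_opp V W (f : V -> W) : bounded_op f -> bounded_op (fun v => - f v).
Proof.
move=> fb; split=> [a u v|]; first by rewrite fb.1 opprD scalerN.
by have [_ [C hC]] := fb; exists C => v; rewrite normrN.
Qed.

Lemma normr_fst_le V W (p : V * W) : `|p.1| <= `|p|.
Proof. by rewrite prod_normE comparable_le_max ?real_comparable // lexx. Qed.

Lemma normr_snd_le V W (p : V * W) : `|p.2| <= `|p|.
Proof. by rewrite prod_normE comparable_le_max ?real_comparable // lexx orbT. Qed.

Lemma normr_pair_le V W (p : V * W) : `|p| <= `|p.1| + `|p.2|.
Proof.
rewrite prod_normE comparable_ge_max ?real_comparable //.
by rewrite lerDl lerDr !normr_ge0.
Qed.

Lemma bop_fst V W : bounded_op (fst : V * W -> V).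
Proof. by split=> //; exists 1 => v; rewrite mul1r normr_fst_le. Qed.

Lemma bop_snd V W : bounded_op (snd : V * W -> W).
Proof. by split=> //; exists 1 => v; rewrite mul1r normr_snd_le. Qed.

Lemma bop_pair U V W (f : U -> V) (g : U -> W) :
  bounded_op f -> bounded_op g -> bounded_op (fun u => (f u, g u)).
Proof.
move=> fb gb; split=> [a u v|]; first by rewrite fb.1 gb.1.
have [_ [C hC]] := fb; have [_ [D hD]] := gb.
exists (C + D) => v; rewrite (le_trans (normr_pair_le _)) // mulrDl.
by rewrite /= lerD.
Qed.

Lemma bop_inl V W : bounded_op (fun v : V => (v, 0 : W)).
Proof. exact: bop_pair (bop_id V) (bop_0 V W). Qed.

Lemma bop_inr V W : bounded_op (fun w : W => (0 : V, w)).
Proof. exact: bop_pair (bop_0 W V) (bop_id W). Qed.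

End BoundedOperators.

(** * The uniform boundedness principle *)

(** The scalars are only assumed to be Archimedean, which covers the real and the
    complex case at once. *)

Section UniformBoundedness.
Context {K : numFieldType} (arch : forall x : K, exists n, `|x| <= n%:R).
Context (V : completeNormedModType K) (W : normedModType K).

Lemma exists_le_both (a b : K) : 0 < a -> 0 < b ->
  exists c, [/\ 0 < c, c <= a & c <= b].
Proof.
move=> a0 b0; case: (real_leP (gtr0_real a0) (gtr0_real b0)) => h.
  by exists a.
by exists b; split=> //; exact: ltW.
Qed.

Lemma halving_small (e : K) : 0 < e -> exists n, (1 / 2 : K) ^+ n < e.
Proof.
move=> e0; have [n hn] := arch e^-1.
exists n; rewrite div1r exprVn invf_plt ?posrE ?exprn_gt0 //.
rewrite gtr0_norm ?invr_gt0 // in hn.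
by rewrite (le_lt_trans hn) // -natrX ltr_nat ltn_expl.
Qed.

Lemma locally_large (f : V -> W) (c : V) (r M : K) : bounded_op f ->
  0 < r -> M < `|f c| ->
  exists s, [/\ 0 < s, s <= r & forall z, `|z - c| <= s -> M < `|f z|].
Proof.
move=> fb r0 Mf; have [C [C0 hC]] := op_bound fb.
have d0 : 0 < (`|f c| - M) / 2 / C by rewrite !divr_gt0 // subr_gt0.
have [s [s0 sr sd]] := exists_le_both r0 d0.
exists s; split=> // z zs.
have h : `|f z - f c| <= (`|f c| - M) / 2.
  rewrite -(opB fb) (le_trans (hC _)) //.
  by rewrite -ler_pdivlMl // mulrC (le_trans zs).
have h2 : `|f c| <= `|f z| + `|f z - f c|.
  rewrite distrC -{1}(subrK (f z) (f c)) addrC; exact: ler_normD.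
have h3 : (`|f c| - M) / 2 < `|f c| - M.
  by rewrite ltr_pdivrMr // ltr_pMr ?subr_gt0 // ltr1n.
have : `|f c| < `|f z| + (`|f c| - M).
  by rewrite (le_lt_trans h2) // ltrD2l (le_lt_trans h).
by rewrite addrCA ltrDl subr_gt0.
Qed.

(** The Baire category part of the proof: nested balls on which some [P n]
    exceeds 0, 1, 2, and so on would shrink to a point of unboundedness. *)
Lemma bounded_on_a_ball (P : nat -> V -> W) :
  (forall n, bounded_op (P n)) ->
  (forall v, exists C : K, forall n, `|P n v| <= C) ->
  exists (c : V) (r M : K), 0 < r /\
    forall y, `|y - c| <= r -> forall n, `|P n y| <= M.
Proof.
move=> Pb Pp; apply: contrapT => noball.
(* Otherwise every ball contains a smaller one on which some P n is large. *)
have step (x : V * K * nat) : exists y : V * K, 0 < x.1.2 ->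
    [/\ 0 < y.2, y.2 <= x.1.2 / 2, `|y.1 - x.1.1| <= x.1.2 / 2 &
      exists n, forall z, `|z - y.1| <= y.2 -> x.2%:R < `|P n z|].
  case: x => -[c r] k /=; have [r0|] := boolP (0 < r); last by exists (c, r).
  have r20 : 0 < r / 2 by rewrite divr_gt0.
  have [y [yc [n hn]]] : exists y, `|y - c| <= r / 2 /\
      exists n, k%:R < `|P n y|.
    apply: contrapT => h; apply: noball; exists c, (r / 2), k%:R; split=> //.
    move=> y yc n; rewrite real_leNgt ?realn //; apply/negP => hn.
    by apply: h; exists y; split=> //; exists n.
  have [s [s0 sr hs]] := locally_large (Pb n) r20 hn.
  by exists (y, s) => _; split=> //; exists n.
have [g hg] := choice step.
pose fix b k : V * K := if k is k'.+1 then g (b k', k') else (0, 1).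
have b0 k : 0 < (b k).2.
  by elim: k => [|k IH] //=; have [] := hg (b k, k) IH.
have bS k := hg (b k, k) (b0 k).
have small k : (b k).2 <= (1 / 2) ^+ k.
  elim: k => [|k IH]; first by rewrite expr0.
  have [_ h _ _] := bS k; rewrite exprSr (le_trans h) // mulrA mulr1.
  by rewrite ler_pM2r ?invr_gt0.
have nested k m : `|(b (k + m)%N).1 - (b k).1| <= (b k).2.
  (* The slack (b (k + m)).2 is what makes the induction go through. *)
  have : `|(b (k + m)%N).1 - (b k).1| + (b (k + m)%N).2 <= (b k).2.
    elim: m => [|m IH]; first by rewrite addn0 subrr normr0 add0r.
    rewrite addnS; have [_ h1 h2 _] := bS (k + m)%N.
    apply: le_trans IH; rewrite (splitr (b (k + m)%N).2).
    have tri := ler_distD (b (k + m)%N).1 (b (k + m).+1).1 (b k).1.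
    by rewrite (le_trans (lerD tri (lexx _))) // addrAC [leLHS]addrC lerD2l lerD.
  by apply: le_trans; rewrite lerDl ltW.
have [l hl] : exists l : V, (fun k => (b k).1) @ \oo --> l.
  apply: cauchy_seq_cvg => e /halving_small [N hN]; exists N => n Nn.
  rewrite distrC -(subnKC Nn) (le_lt_trans (nested _ _)) //.
  exact: le_lt_trans (small N) hN.
have [C hC] := Pp l; have [m hm] := arch C.
have [_ _ _ [n hn]] := bS m.
rewrite ger0_norm ?(le_trans _ (hC n)) // in hm.
have /lt_le_trans/(_ (le_trans (hC n) hm)) : m%:R < `|P n l|.
  apply: hn; apply: (limit_norm_le (N := m.+1) hl) => j mj.
  by rewrite -(subnKC mj); exact: nested.
by rewrite ltxx.
Qed.

Theorem uniform_boundedness (P : nat -> V -> W) :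
  (forall n, bounded_op (P n)) ->
  (forall v, exists C : K, forall n, `|P n v| <= C) ->
  exists C : K, forall n v, `|P n v| <= C * `|v|.
Proof.
move=> Pb Pp; have [c [r [M [r0 hM]]]] := bounded_on_a_ball Pb Pp.
exists ((M + M) / r) => n v.
have [->|v0] := eqVneq v 0; first by rewrite (op0 (Pb n)) !normr0 mulr0.
have nv : 0 < `|v| by rewrite normr_gt0.
pose t := r / `|v|.
have t0 : 0 < t by rewrite divr_gt0.
have h1 : `|P n (c + t *: v)| <= M.
  by apply: hM; rewrite addrC addKr normrZ gtr0_norm // divfK ?gt_eqF.
have h2 : `|P n c| <= M by apply: hM; rewrite subrr normr0 ltW.
have h : t * `|P n v| <= M + M.
  rewrite -[t]gtr0_norm // -normrZ -(opZ (Pb n)).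
  rewrite -[t *: v](addKr c) addrC (opB (Pb n)).
  by rewrite (le_trans (ler_normB _ _)) // lerD.
by rewrite mulrAC ler_pdivlMr // -ler_pdivrMr // -mulrA mulrC.
Qed.

End UniformBoundedness.

(** * Isomorphisms *)

Section Isomorphisms.
Context {K : numFieldType}.
Implicit Types U V W : normedModType K.

Lemma isomorphism_on_comp U V W (S : set U) (S' : set V) (S'' : set W)
    (f : U -> V) (g : V -> W) :
  isomorphism_on S S' f -> isomorphism_on S' S'' g ->
  isomorphism_on S S'' (g \o f).
Proof.
move=> [fl fbij [C hC] [D hD]] [gl gbij [C' hC'] [D' hD']].
have fS v : S v -> S' (f v) by case: fbij => + _ _; apply.
have [A [A0 hA]] := positive_bound hC'; have [B [B0 hB]] := positive_bound hD.
split.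
- by move=> a u v Su Sv; rewrite /= fl // gl //; exact: fS.
- exact: set_bij_comp fbij gbij.
- exists (A * C) => v Sv /=; rewrite (le_trans (hA _ (fS _ Sv))) //.
  by rewrite -mulrA ler_pM2l // hC.
- exists (B * D') => v Sv /=; rewrite (le_trans (hB _ Sv)) //.
  by rewrite -mulrA ler_pM2l // hD' //; exact: fS.
Qed.

Lemma isomorphic_on_trans U V W (S : set U) (S' : set V) (S'' : set W) :
  isomorphic_on S S' -> isomorphic_on S' S'' -> isomorphic_on S S''.
Proof.
move=> [f fi] [g gi]; exists (g \o f); exact: isomorphism_on_comp fi gi.
Qed.

Lemma isomorphism_onT V W (T : V -> W) :
  isomorphism_on [set: V] [set: W] T ->
  exists g, [/\ bounded_op T, bounded_op g, cancel T g & cancel g T].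
Proof.
move=> [Tl + [C hC] [D hD]]; rewrite setTT_bijective => -[g fg gf].
exists g; split=> //.
  by split=> [a u v|]; [exact: Tl|exists C => v; exact: hC].
split=> [a u v|]; last by exists D => v; rewrite -{2}(gf v); exact: hD.
by apply: (can_inj fg); rewrite Tl // !gf.
Qed.

Lemma isomorphicP V W : isomorphic V W <->
  exists (f : V -> W) (g : W -> V),
    [/\ bounded_op f, bounded_op g, cancel f g & cancel g f].
Proof.
split=> [[T /isomorphism_onT[g Tg]]|[f [g [fb gb fg gf]]]]; first by exists T, g.
exists f; split=> //.
- by move=> a u v _ _; exact: fb.1.
- by rewrite setTT_bijective; exists g.
- by have [_ [C hC]] := fb; exists C.
- by have [_ [C hC]] := gb; exists C => v _; rewrite -{1}(fg v).
Qed.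

Lemma isomorphic_refl V : isomorphic V V.
Proof. by apply/isomorphicP; exists id, id; split=> //; exact: bop_id. Qed.

Lemma isomorphic_sym V W : isomorphic V W -> isomorphic W V.
Proof.
by move=> /isomorphicP[f [g [*]]]; apply/isomorphicP; exists g, f; split.
Qed.

Lemma isomorphic_trans U V W :
  isomorphic U V -> isomorphic V W -> isomorphic U W.
Proof. exact: isomorphic_on_trans. Qed.

Lemma isomorphic_prod (V V' W W' : normedModType K) :
  isomorphic V V' -> isomorphic W W' ->
  isomorphic (V * W)%type (V' * W')%type.
Proof.
move=> /isomorphicP[f [g [fb gb fg gf]]] /isomorphicP[h [k [hb kb hk kh]]].
apply/isomorphicP.
exists (fun p => (f p.1, h p.2)), (fun p => (g p.1, k p.2)); split.
- by apply: bop_pair; apply: bop_comp => //; [exact: bop_fst|exact: bop_snd].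
- by apply: bop_pair; apply: bop_comp => //; [exact: bop_fst|exact: bop_snd].
- by move=> [u v] /=; rewrite fg hk.
- by move=> [u v] /=; rewrite gf kh.
Qed.

Lemma isomorphic_prodA U V W :
  isomorphic ((U * V) * W)%type (U * (V * W))%type.
Proof.
apply/isomorphicP.
exists (fun p => (p.1.1, (p.1.2, p.2))), (fun p => ((p.1, p.2.1), p.2.2)).
have f := @bop_fst K; have s := @bop_snd K.
split; [| |by move=> [[]]|by move=> [? []]].
- apply: bop_pair; first exact: bop_comp (f _ _) (f _ _).
  by apply: bop_pair; [exact: bop_comp (s _ _) (f _ _)|exact: s].
- apply: bop_pair; last exact: bop_comp (s _ _) (s _ _).
  by apply: bop_pair; [exact: f|exact: bop_comp (f _ _) (s _ _)].
Qed.

Lemma isomorphic_prodC V W : isomorphic (V * W)%type (W * V)%type.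
Proof.
apply/isomorphicP; exists (fun p => (p.2, p.1)), (fun p => (p.2, p.1)).
have h X Y := bop_pair (@bop_snd K X Y) (@bop_fst K X Y).
by split; [exact: h|exact: h|move=> []|move=> []].
Qed.

Lemma isomorphic_prod0 V W : (forall w : W, w = 0) -> isomorphic (V * W)%type V.
Proof.
move=> W0; apply/isomorphicP; exists fst, (fun v => (v, 0)).
split=> [| | |v //]; [exact: bop_fst|exact: bop_inl|].
by move=> [v w] /=; rewrite (W0 w).
Qed.

(** The isomorphism is [g^-1 \o f] for two isomorphisms [f], [g] onto [S]. *)
Lemma isomorphic_common_image V W U (S : set U) :
  isomorphic_on [set: V] S -> isomorphic_on [set: W] S -> isomorphic V W.
Proof.
suff inv V' W' (f : V' -> U) (g : W' -> U) : isomorphism_on [set: V'] S f ->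
    isomorphism_on [set: W'] S g ->
    exists2 h, bounded_op h & forall v, g (h v) = f v.
  move=> [f fi] [g gi]; have [h hb gh] := inv _ _ _ _ fi gi.
  have [k kb fk] := inv _ _ _ _ gi fi.
  have inj V' (f' : V' -> U) : isomorphism_on [set: V'] S f' -> injective f'.
    by move=> [_ [_ i _] _ _] u v; apply: i; rewrite in_setT.
  apply/isomorphicP; exists h, k; split=> // v.
    by apply: (inj _ _ fi); rewrite fk gh.
  by apply: (inj _ _ gi); rewrite gh fk.
move=> [fl [fS _ _] [C hC] _] [gl [_ ginj gsurj] _ [D hD]].
have /choice [h gh] v : exists w, g w = f v.
  by have [w _ <-] := gsurj _ (fS _ I : S (f v)); exists w.
have [A [A0 hA]] := positive_bound hD.
exists h => //; split=> [a u v|].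
  by apply: ginj; rewrite ?in_setT // gl // !gh fl.
exists (A * C) => v; rewrite (le_trans (hA _ I)) // gh -mulrA ler_pM2l //.
exact: hC.
Qed.

End Isomorphisms.

(** * Unconditional convergence *)

Lemma set_bij_id (T : Type) (D : set T) : set_bij D D id.
Proof. by split=> // i Di; exists i. Qed.

Section UnorderedSums.
Context {K : numFieldType}.
Implicit Types (V W : normedModType K) (D : set nat) (a : nat -> K).

(** Convergence of the net of finite partial sums.  Unlike convergence of the
    series it does not refer to the order of the indices, so that families over
    different index sets can be merged and split freely. *)
Definition unordered_sum V D a (x : nat -> V) (v : V) : Prop :=
  forall e : K, 0 < e -> exists N, forall s : seq nat, uniq s ->
    (forall i, i \in s -> D i) -> (forall i, (i < N)%N -> D i -> i \in s) ->
    `|v - \sum_(i <- s) a i *: x i| < e.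

Definition initial D m : seq nat := [seq i <- iota 0 m | i \in D].

Lemma mem_initial D m i : (i \in initial D m) <-> (i < m)%N /\ D i.
Proof.
rewrite mem_filter mem_iota add0n /=; split=> [/andP[/set_mem Di ->] //|].
by move=> [-> Di]; rewrite andbT; exact/mem_set.
Qed.

Lemma initial_uniq D m : uniq (initial D m).
Proof. by rewrite filter_uniq // iota_uniq. Qed.

Lemma partial_sumE V D a (x : nat -> V) m :
  partial_sum D a x m = \sum_(i <- initial D m) a i *: x i.
Proof.
rewrite /partial_sum /initial big_filter.
by rewrite -(big_mkord (fun i => i \in D) (fun i => a i *: x i)) /index_iota subn0.
Qed.

Lemma bounded_preimage D D' (p : nat -> nat) N : set_bij D' D p ->
  exists M, forall i, (i < N)%N -> D i -> exists2 j, (j < M)%N & D' j /\ p j = i.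
Proof.
move=> [_ _ psurj]; elim: N => [|N [M hM]]; first by exists 0%N.
have [DN|nDN] := pselect (D N); last first.
  exists M => i; rewrite ltnS leq_eqVlt => /predU1P[-> //|]; exact: hM.
have [j Dj pj] := psurj _ DN.
exists (maxn M j.+1) => i; rewrite ltnS leq_eqVlt => /predU1P[-> _|iN Di].
  by exists j; rewrite // leq_max leqnn orbT.
by have [k kM hk] := hM _ iN Di; exists k; rewrite // leq_max kM.
Qed.

Lemma unordered_sum_rearranged V D D' a (x : nat -> V) v (p : nat -> nat) :
  set_bij D' D p -> unordered_sum D a x v -> expands D' (x \o p) (a \o p) v.
Proof.
move=> pbij sv; apply/cvg_epsP => e /sv [N hN].
have [M hM] := bounded_preimage N pbij; exists M => m Mm.
rewrite partial_sumE /= -(big_map p xpredT (fun i => a i *: x i)).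
have [pD pinj _] := pbij.
apply: hN.
- rewrite map_inj_in_uniq ?initial_uniq // => i j.
  by move=> /mem_initial[_ Di] /mem_initial[_ Dj]; apply: pinj; exact/mem_set.
- by move=> _ /mapP[i /mem_initial[_ Di] ->]; exact: pD.
- move=> i iN Di; have [j jM [Dj <-]] := hM _ iN Di.
  by apply/map_f/mem_initial; split=> //; exact: leq_trans Mm.
Qed.

Lemma unordered_sum_expands V D a (x : nat -> V) v :
  unordered_sum D a x v -> expands D x a v.
Proof. exact: (unordered_sum_rearranged (p := id)) (set_bij_id _). Qed.

(** Sums over finite sets beyond [N] are differences of two sums close to [v]. *)
Lemma unordered_sum_tail V D a (x : nat -> V) v : unordered_sum D a x v ->
  forall e : K, 0 < e -> exists N, forall s : seq nat, uniq s ->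
    (forall i, i \in s -> D i /\ (N <= i)%N) ->
    `|\sum_(i <- s) a i *: x i| < e.
Proof.
move=> sv e e0; have /sv [N hN] : 0 < e / 2 by rewrite divr_gt0.
exists N => s us Ds.
have h1 : `|v - \sum_(i <- initial D N) a i *: x i| < e / 2.
  by apply: hN; [exact: initial_uniq|move=> i /mem_initial[]|
    move=> i iN Di; exact/mem_initial].
have h2 : `|v - \sum_(i <- initial D N ++ s) a i *: x i| < e / 2.
  apply: hN.
  - rewrite cat_uniq initial_uniq us andbT /=; apply/hasPn => i /Ds [_ Ni].
    by apply/negP => /mem_initial[]; rewrite ltnNge Ni.
  - by move=> i; rewrite mem_cat => /orP[/mem_initial[]|/Ds[]].
  - by move=> i iN Di; rewrite mem_cat; apply/orP; left; exact/mem_initial.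
rewrite (splitr e); apply: le_lt_trans (ltrD h1 h2).
rewrite big_cat /=; set A := \sum_(i <- initial D N) _; set B := \sum_(i <- s) _.
have h : (v - A) - (v - (A + B)) = B by rewrite opprB addrC subrKA addrC addKr.
by rewrite -{1}h; exact: ler_normB.
Qed.

Lemma op_unordered_sum V W (f : V -> W) D a (x : nat -> V) v :
  bounded_op f -> unordered_sum D a x v -> unordered_sum D a (f \o x) (f v).
Proof.
move=> fb sv e e0; have [C [C0 hC]] := op_bound fb.
have /sv [N hN] : 0 < e / C by rewrite divr_gt0.
exists N => s us Ds Ns; have := hN s us Ds Ns.
rewrite ltr_pdivlMr // mulrC; apply: le_lt_trans.
under eq_bigr do rewrite /= -(opZ fb).
by rewrite -(op_sum fb) -(opB fb).
Qed.

End UnorderedSums.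

(** Given finite sets [F N] containing the initial segments [0, N), a permutation
    of the natural numbers infinitely many of whose initial segments are sets of
    the form [F N].  It enumerates some [F N], then what is missing of a [F N']
    that contains all the numbers enumerated so far, and so on. *)
Section BlockEnumeration.
Context (F : nat -> seq nat) (F_uniq : forall N, uniq (F N)).
Context (F_initial : forall N i, (i < N)%N -> i \in F N).

Let bound (s : seq nat) k := ((\max_(i <- s) i).+1 + k)%N.

Fixpoint block k : seq nat :=
  if k is k'.+1
  then block k' ++ [seq i <- F (bound (block k') k) | i \notin block k']
  else [::].

Definition block_perm i : nat := nth 0%N (block i.+1) i.

Lemma block_uniq k : uniq (block k).
Proof.
elim: k => //= k IH; rewrite cat_uniq IH filter_uniq // andbT /=.
by apply/hasPn => i; rewrite mem_filter => /andP[].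
Qed.

Lemma block_perm_eq k : exists N, perm_eq (block k.+1) (F N).
Proof.
exists (bound (block k) k.+1); apply: uniq_perm => //; first exact: block_uniq.
move=> i; rewrite /= mem_cat mem_filter; case: (boolP (i \in block k)) => //= ik.
symmetry; apply: F_initial; rewrite /bound addSn ltnS -[i in (i <= _)%N]addn0.
apply: leq_add => //.
exact: (@leq_bigmax_seq _ (block k) predT id).
Qed.

Lemma block_mem k i : (i < k)%N -> i \in block k.
Proof.
case: k => // k ik /=; rewrite mem_cat mem_filter.
case: (boolP (i \in block k)) => //= _; apply: F_initial.
by rewrite /bound (leq_trans ik) // leq_addl.
Qed.

Lemma block_size k : (k <= size (block k))%N.
Proof.
rewrite -[k in (k <= _)%N](size_iota 0); apply: uniq_leq_size (iota_uniq _ _) _.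
by move=> i; rewrite mem_iota add0n => /andP[_]; exact: block_mem.
Qed.

(* Each block is a prefix of the next ones. *)
Lemma block_nth k m i : (i < size (block k))%N ->
  nth 0%N (block (k + m)) i = nth 0%N (block k) i.
Proof.
move=> ik; suff : exists t, block (k + m) = block k ++ t.
  by move=> [t ->]; rewrite nth_cat ik.
elim: m => [|m [t ht]]; first by exists [::]; rewrite addn0 cats0.
by rewrite addnS /= ht -catA; eexists.
Qed.

Lemma block_permE k i : (i < size (block k))%N ->
  block_perm i = nth 0%N (block k) i.
Proof.
move=> ik; have ii := block_size i.+1; rewrite /block_perm.
by case: (leqP k i.+1) => [h|/ltnW h]; rewrite -(subnKC h) block_nth // subnKC.
Qed.

Lemma block_perm_bij : set_bij [set: nat] [set: nat] block_perm.
Proof.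
split=> // [i j _ _|n _].
  have ii := leq_trans (leq_maxl i.+1 j.+1) (block_size _).
  have jj := leq_trans (leq_maxr i.+1 j.+1) (block_size _).
  rewrite (block_permE ii) (block_permE jj) => /eqP.
  by rewrite nth_uniq ?block_uniq // => /eqP.
have nn : n \in block n.+1 by apply: block_mem.
exists (index n (block n.+1)) => //.
by rewrite (@block_permE n.+1) ?index_mem // nth_index.
Qed.

Lemma block_perm_map k :
  [seq block_perm i | i <- iota 0 (size (block k))] = block k.
Proof.
rewrite -[RHS](mkseq_nth 0%N) /mkseq; apply/eq_in_map => i.
by rewrite mem_iota add0n => /andP[_]; exact: block_permE.
Qed.

End BlockEnumeration.

Section Rearrangements.
Context {K : numFieldType}.
Implicit Types (V W : normedModType K) (D : set nat) (a : nat -> K).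

Lemma initialT m : initial [set: nat] m = iota 0 m.
Proof.
rewrite /initial (eq_filter (a2 := predT)) ?filter_predT // => i.
by rewrite in_setT.
Qed.

(** If the finite sums do not converge to [v], there are finite sets [F N]
    containing [0, N) with sums far from [v]; the series rearranged by
    [block_perm F] then does not converge to [v]. *)
Lemma rearranged_unordered_sum V D a (x : nat -> V) v : index_set D ->
  (forall p, set_bij D D p -> expands D (x \o p) (a \o p) v) ->
  unordered_sum D a x v.
Proof.
move=> [->|[k ->]] xv e e0; last first.
  have /cvg_epsP/(_ _ e0) [N hN] := xv id (set_bij_id _).
  exists k => s us sk ks; have := hN _ (leq_maxl N k).
  suff pe : perm_eq (initial `I_k (maxn N k)) s.
    by rewrite partial_sumE /= (perm_big _ pe).
  apply: uniq_perm => //; first exact: initial_uniq.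
  move=> i; apply/idP/idP => [/mem_initial[_ ik]|/sk ik]; first exact: ks.
  by apply/mem_initial; rewrite leq_max ik orbT.
apply: contrapT => /forallNP bad.
have /choice [F hF] N : exists s, [/\ uniq s, forall i, (i < N)%N -> i \in s &
    ~ `|v - \sum_(i <- s) a i *: x i| < e].
  apply: contrapT => /forallNP h; apply: (bad N) => s us _ sN.
  apply: contrapT => h2; apply: (h s); split=> // i iN; exact: sN.
have F_uniq N : uniq (F N) by have [] := hF N.
have F_in N i : (i < N)%N -> i \in F N by have [_ h _] := hF N; exact: h.
have /cvg_epsP/(_ _ e0) [M hM] := xv _ (block_perm_bij F_uniq F_in).
have [k Mk [N perm]] : exists2 k, (M <= k)%N &
    exists N, perm_eq (block F k) (F N).
  by exists M.+1 => //; exact: block_perm_eq.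
have [_ _] := hF N; apply.
have := hM _ (leq_trans Mk (block_size F_in k)).
rewrite partial_sumE initialT /=.
rewrite -(big_map (block_perm F) xpredT (fun i => a i *: x i)).
by rewrite block_perm_map // (perm_big _ perm).
Qed.

End Rearrangements.

(** * Unconditional bases *)

Section Bases.
Context {K : numFieldType}.
Implicit Types (V W : normedModType K) (D : set nat) (a : nat -> K).

Lemma expands_op V W (f : V -> W) D a (x : nat -> V) v :
  bounded_op f -> expands D x a v -> expands D (f \o x) a (f v).
Proof.
move=> fb xv; rewrite /expands (_ : (fun m => _) = f \o partial_sum D a x).
  exact: (op_cvg fb xv).
apply/funext => m; rewrite /= !partial_sumE (op_sum fb).
by apply: eq_bigr => i _; rewrite (opZ fb).
Qed.

Lemma eq_expands V D (x y : nat -> V) a b v :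
  (forall i, D i -> b i *: y i = a i *: x i) ->
  expands D x a v -> expands D y b v.
Proof.
move=> yx xv; rewrite /expands (_ : (fun m => _) = partial_sum D a x) //.
apply/funext => m; rewrite !partial_sumE; apply: eq_big_seq => i.
by move=> /mem_initial[_]; exact: yx.
Qed.

Lemma retraction_basis V W (J : V -> W) (R : W -> V) D (x : nat -> V) :
  bounded_op J -> bounded_op R -> cancel J R ->
  unconditional_basis [set: V] D x -> unconditional_basis (range J) D (J \o x).
Proof.
move=> Jb Rb JK [[_ xe] xu].
have back a v : expands D (J \o x) a (J v) -> expands D x a v.
  move=> /(expands_op Rb); rewrite JK; apply: eq_expands => i _ /=.
  by rewrite JK.
split; first split.
- by move=> i Di; exists (x i).
- move=> _ [v _ <-]; have [a [av au]] := xe v I.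
  exists a; split; first exact: expands_op.
  by move=> b /back /au.
- move=> _ a [v _ <-] /back av p pbij.
  by apply: (expands_op Jb); exact: xu.
Qed.

Lemma scaled_basis V (S : set V) D (x : nat -> V) (c : nat -> K) :
  (forall i, D i -> c i != 0) -> (forall i, D i -> S (c i *: x i)) ->
  unconditional_basis S D x -> unconditional_basis S D (fun i => c i *: x i).
Proof.
move=> c0 Sc [[_ xe] xu].
have fwd a v : expands D (fun i => c i *: x i) a v ->
    expands D x (fun i => a i * c i) v.
  by apply: eq_expands => i _; rewrite scalerA.
have cK a i : D i -> a i / c i * c i = a i by move=> /c0 ci; rewrite divfK.
split; first split=> //.
  move=> v /xe [a [av au]]; exists (fun i => a i / c i); split.
    by apply: eq_expands av => i Di; rewrite scalerA cK.
  by move=> b /fwd /au h i Di; rewrite -(h _ Di) mulfK // c0.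
move=> v a Sv /fwd av p pbij; have := xu v _ Sv av p pbij.
by apply: eq_expands => i Di /=; rewrite scalerA.
Qed.

(** Adding 1 to the coefficient of a zero vector would not change the sum. *)
Lemma basis_neq0 V (S : set V) D (x : nat -> V) i :
  unconditional_basis S D x -> D i -> x i != 0.
Proof.
move=> [[Sx xe] _] Di; apply/eqP => xi0; have [a [av au]] := xe _ (Sx _ Di).
have /au/(_ _ Di)/eqP : expands D x (fun j => a j + (j == i)%:R) (x i).
  apply: eq_expands av => j _; have [->|] := eqVneq j i.
    by rewrite xi0 !scaler0.
  by rewrite addr0.
by rewrite eqxx -subr_eq0 addrC addKr oner_eq0.
Qed.

Lemma basis_unordered_sum V (S : set V) D (x : nat -> V) v :
  index_set D -> unconditional_basis S D x -> S v ->
  exists a, unordered_sum D a x v.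
Proof.
move=> Dix [[_ xe] xu] Sv; have [a [av _]] := xe v Sv.
by exists a; apply: rearranged_unordered_sum Dix _ => p; exact: xu.
Qed.

Lemma basis_I0 V (x : nat -> V) :
  unconditional_basis [set: V] `I_0 x -> forall v : V, v = 0.
Proof.
move=> [[_ xe] _] v; have [a [/cvg_epsP av _]] := xe v I.
apply/eqP; rewrite -normr_le0; apply/ler_addgt0Pr => e /av [N /(_ N (leqnn N))].
rewrite partial_sumE big_seq big1 ?subr0 ?add0r => [/ltW //|i].
by move=> /mem_initial[].
Qed.

End Bases.

Section InfiniteBases.
Context {K : numFieldType}.

Lemma linear_spanP (V : normedModType K) k (e : nat -> V) v :
  linear_span `I_k e v -> exists c : 'rV[K]_k, v = \sum_(j < k) c 0 j *: e j.
Proof.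
move=> [m [a ->]]; exists (\row_(j < k) (if (j < m)%N then a j else 0)).
rewrite partial_sumE.
under [RHS]eq_bigr do rewrite mxE.
rewrite -(big_mkord xpredT (fun j => (if (j < m)%N then a j else 0) *: e j)).
rewrite /index_iota subn0 [RHS](bigID (fun j => (j < m)%N)) /=.
rewrite [X in _ + X]big1 ?addr0 => [|j /negbTE ->]; last by rewrite scale0r.
under [RHS]eq_bigr => j jm do rewrite jm.
rewrite -[RHS]big_filter; apply: perm_big; apply: uniq_perm.
- exact: initial_uniq.
- by rewrite filter_uniq // iota_uniq.
- move=> i; rewrite [RHS]mem_filter mem_iota /= add0n.
  by apply/idP/andP => [/mem_initial|h]; last exact/mem_initial.
Qed.

Lemma infinite_basis_not_finite_dimensional (V : normedModType K) (S : set V) x :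
  unconditional_basis S [set: nat] x -> ~ finite_dimensional S.
Proof.
move=> [[Sx xe] _] [k [e Se]].
have /choice [A hA] i : exists c : 'rV[K]_k, x i = \sum_(j < k) c 0 j *: e j.
  by apply: linear_spanP; apply: Se; exact: Sx.
(* k.+1 vectors in the span of k vectors satisfy a nontrivial relation d. *)
pose M := \matrix_(i < k.+1) A i.
have /rowV0Pn [d /sub_kermxP dM d0] : kermx M != 0.
  rewrite kermx_eq0 -row_leq_rank -ltnNge ltnS; exact: rank_leq_col.
have rel : \sum_(i < k.+1) d 0 i *: x i = 0.
  under eq_bigr do rewrite hA scaler_sumr.
  rewrite exchange_big /= big1 // => j _.
  under eq_bigr do rewrite scalerA.
  rewrite -scaler_suml; have := congr1 (fun N : 'rV[K]_k => N 0 j) dM.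
  rewrite !mxE => h; rewrite (_ : \sum_i _ = 0) ?scale0r // -[RHS]h.
  by apply: eq_bigr => i _; rewrite !mxE.
have [a [/cvg_epsP av au]] := xe _ (Sx 0%N I).
have [i di] : exists i, d 0 i != 0.
  apply: contrapT => /forallNP h; move/eqP: d0; apply; apply/rowP => i.
  by rewrite mxE; apply/eqP; apply: contrapT => /negP/h.
pose d' j := if insub j is Some o then d 0 o else 0 : K.
have d'0 j : (k < j)%N -> d' j = 0 by move=> kj; rewrite /d' insubF // ltnNge kj.
have sum_d' n : (k < n)%N ->
    \sum_(j <- iota 0 n) d' j *: x j = \sum_(j < k.+1) d' j *: x j.
  move: (k.+1) d'0 => q d'0 qn; rewrite -(subnKC qn) iotaD big_cat /= add0n.
  rewrite [X in _ + X]big_seq [X in _ + X]big1 ?addr0 => [|j]; last first.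
    by rewrite mem_iota => /andP[/d'0 -> _]; rewrite scale0r.
  by rewrite -[X in iota 0 X]subn0 -/(index_iota 0 q) big_mkord.
have /au/(_ i I)/eqP : expands [set: nat] x (fun j => a j + d' j) (x 0%N).
  apply/cvg_epsP => r /av [N hN]; exists (maxn N k.+1) => n.
  rewrite geq_max => /andP[/hN h kn].
  suff -> : partial_sum [set: nat] (fun j => a j + d' j) x n =
      partial_sum [set: nat] a x n by [].
  rewrite !partial_sumE initialT.
  under eq_bigr do rewrite scalerDl.
  rewrite big_split /= [X in _ + X](_ : _ = 0) ?addr0 // (sum_d' _ kn) -[RHS]rel.
  by apply: eq_bigr => j _; rewrite /d' valK.
by rewrite -subr_eq0 addrC addKr /d' valK (negbTE di).
Qed.

End InfiniteBases.

(** A sequence [x] over [D] which consists of the vectors [u], at the places given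
    by the increasing map [h], and of zeros.  The components of a basis of a
    product are of this kind.  That [h] is increasing lets convergence of the
    series, and not only unconditional convergence, pass from [x] to [u]: this is
    needed for the uniqueness of expansions in a Schauder basis. *)
Section Embedding.
Context {K : numFieldType} {V : normedModType K}.
Context (D1 D : set nat) (h : nat -> nat) (u x : nat -> V).
Context (h_mono : {mono h : i j / (i < j)%N}).
Context (hx : forall j, D1 j -> D (h j) /\ x (h j) = u j).
Context (x0 : forall i, D i -> (exists2 j, D1 j & i = h j) \/ x i = 0).

Lemma increasing_inj : injective h.
Proof.
by move=> i j hij; case: (ltngtP i j) => //; rewrite -h_mono hij ltnn.
Qed.

Lemma increasing_ge n : (n <= h n)%N.
Proof. by elim: n => // n IH; rewrite (leq_ltn_trans IH) // h_mono. Qed.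

Lemma embedded_sum (c : nat -> K) s s' : uniq s -> uniq s' ->
  (forall i, i \in s -> D i) -> (forall j, j \in s' <-> D1 j /\ h j \in s) ->
  \sum_(i <- s) c i *: x i = \sum_(j <- s') c (h j) *: u j.
Proof.
move=> us us' Ds hs; rewrite (bigID (fun i => `[< exists2 j, D1 j & i = h j >])) /=.
rewrite [X in _ + X]big_seq_cond [X in _ + X]big1 ?addr0; last first.
  move=> i /andP[/Ds/x0 [] //]; last by move=> -> _; rewrite scaler0.
  by move=> hi /asboolPn.
rewrite -big_filter (perm_big [seq h j | j <- s']).
  by rewrite big_map; apply: eq_big_seq => j /hs[/hx[_ ->]].
apply: uniq_perm; first by rewrite filter_uniq.
  by rewrite map_inj_uniq //; exact: increasing_inj.
move=> i; rewrite mem_filter; apply/andP/mapP.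
  by move=> [/asboolP[j Dj ->] his]; exists j => //; apply/hs.
by move=> [j /hs[Dj hj] ->]; split=> //; apply/asboolP; exists j.
Qed.

Lemma embedded_partial_sum (c : nat -> K) m :
  partial_sum D c x (h m) = partial_sum D1 (c \o h) u m.
Proof.
rewrite !partial_sumE; apply: embedded_sum; try exact: initial_uniq.
  by move=> i /mem_initial[].
move=> j; rewrite !mem_initial h_mono.
by split=> [[jm Dj]|[Dj [jm _]]]; have [] := hx Dj.
Qed.

Lemma embedded_expands (c : nat -> K) v :
  expands D x c v -> expands D1 u (c \o h) v.
Proof.
move=> /cvg_epsP xv; apply/cvg_epsP => e /xv [N hN]; exists N => n Nn.
rewrite -embedded_partial_sum; apply: hN.
exact: leq_trans (increasing_ge n).
Qed.

Lemma embedded_unordered_sum (a c : nat -> K) v :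
  (forall j, D1 j -> c (h j) = a j) ->
  unordered_sum D1 a u v -> unordered_sum D c x v.
Proof.
move=> ca uv e /uv [N hN]; exists (h N) => s us Ds Ns.
pose M := (\max_(i <- s) i).+1.
pose s' := [seq j <- initial D1 M | h j \in s].
have us' : uniq s' by rewrite filter_uniq // initial_uniq.
have hs j : j \in s' <-> D1 j /\ h j \in s.
  rewrite mem_filter; split=> [/andP[hj /mem_initial[]] //|[Dj hj]].
  rewrite hj; apply/mem_initial; split=> //; rewrite ltnS.
  by rewrite (leq_trans (increasing_ge j)) // (@leq_bigmax_seq _ s predT id).
rewrite (embedded_sum c us us' Ds hs).
rewrite (eq_big_seq (fun j => a j *: u j)) => [|j /hs[/ca -> //]].
apply: hN => // [j /hs[]//|j jN Dj]; apply/hs; split=> //.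
by apply: Ns; [rewrite h_mono|have [] := hx Dj].
Qed.

End Embedding.

Section ProductBasis.
Context {K : numFieldType}.

Lemma pair_unordered_sum (V W : normedModType K) D (c : nat -> K)
    (x : nat -> V * W) (v : V) (w : W) :
  unordered_sum D c (fst \o x) v -> unordered_sum D c (snd \o x) w ->
  unordered_sum D c x (v, w).
Proof.
move=> sv sw e e0; have [M hM] := sv e e0; have [N hN] := sw e e0.
exists (maxn M N) => s us Ds Ns.
set q := _ - _; have q1 : q.1 = v - \sum_(i <- s) c i *: (x i).1.
  rewrite /q (opB (bop_fst V W)) (op_sum (bop_fst V W)).
  by [].
have q2 : q.2 = w - \sum_(i <- s) c i *: (x i).2.
  rewrite /q (opB (bop_snd V W)) (op_sum (bop_snd V W)).
  by [].
rewrite prod_normE comparable_gt_max ?real_comparable // q1 q2.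
apply/andP; split.
  by apply: hM => // i iM; apply: Ns; exact: leq_trans (leq_maxl _ _).
by apply: hN => // i iN; apply: Ns; exact: leq_trans (leq_maxr _ _).
Qed.

Context (V W : normedModType K).

(** The map [g] tells whether an index of [D] comes from [D1] or from [D2]. *)
Lemma product_basis_embedded (D1 D2 D : set nat) (u : nat -> V) (v : nat -> W)
    (h1 h2 : nat -> nat) (g : nat -> nat + nat) :
  index_set D1 -> index_set D2 ->
  unconditional_basis [set: V] D1 u -> unconditional_basis [set: W] D2 v ->
  {mono h1 : i j / (i < j)%N} -> {mono h2 : i j / (i < j)%N} ->
  (forall j, D1 j -> D (h1 j) /\ g (h1 j) = inl j) ->
  (forall j, D2 j -> D (h2 j) /\ g (h2 j) = inr j) ->
  (forall i, D i -> match g i with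
                    | inl j => D1 j /\ i = h1 j
                    | inr j => D2 j /\ i = h2 j
                    end) ->
  unconditional_basis [set: V * W] D
    (fun i => match g i with inl j => (u j, 0) | inr j => (0, v j) end).
Proof.
move=> iD1 iD2 ub vb h1m h2m g1 g2 gD.
set b := fun i => _.
have x1 j : D1 j -> D (h1 j) /\ (fst \o b) (h1 j) = u j.
  by move=> /g1[Dj gj]; rewrite /b /= gj.
have x2 j : D2 j -> D (h2 j) /\ (snd \o b) (h2 j) = v j.
  by move=> /g2[Dj gj]; rewrite /b /= gj.
have y1 i : D i -> (exists2 j, D1 j & i = h1 j) \/ (fst \o b) i = 0.
  move=> /gD; rewrite /b /=; case: (g i) => j [Dj ij]; last by right.
  by left; exists j.
have y2 i : D i -> (exists2 j, D2 j & i = h2 j) \/ (snd \o b) i = 0.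
  move=> /gD; rewrite /b /=; case: (g i) => j [Dj ij]; first by right.
  by left; exists j.
pose cc a1 a2 i : K := match g i with inl j => a1 j | inr j => a2 j end.
have sum a1 a2 p q : unordered_sum D1 a1 u p -> unordered_sum D2 a2 v q ->
    unordered_sum D (cc a1 a2) b (p, q).
  move=> up vq; apply: pair_unordered_sum.
    apply: (embedded_unordered_sum h1m x1 y1) up => j /g1[_ gj].
    by rewrite /cc gj.
  apply: (embedded_unordered_sum h2m x2 y2) vq => j /g2[_ gj].
  by rewrite /cc gj.
have coef c p q : expands D b c (p, q) ->
    expands D1 u (c \o h1) p /\ expands D2 v (c \o h2) q.
  move=> bpq; split.
    exact: (embedded_expands h1m x1 y1 (expands_op (bop_fst V W) bpq)).
  exact: (embedded_expands h2m x2 y2 (expands_op (bop_snd V W) bpq)).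
have ex p q : exists a1 a2, [/\ unordered_sum D1 a1 u p, unordered_sum D2 a2 v q &
    forall c, expands D b c (p, q) -> forall i, D i -> c i = cc a1 a2 i].
  have [a1 s1] := basis_unordered_sum (v := p) iD1 ub I.
  have [a2 s2] := basis_unordered_sum (v := q) iD2 vb I.
  exists a1, a2; split=> // c /coef[c1 c2] i Di.
  have [[_ /(_ p I)[a1' [_ u1]]] _] := ub.
  have [[_ /(_ q I)[a2' [_ u2]]] _] := vb.
  rewrite /cc; move: (gD i Di); case: (g i) => j [Dj ->].
    by rewrite -[LHS]/((c \o h1) j) (u1 _ c1) // (u1 _ (unordered_sum_expands s1)).
  by rewrite -[LHS]/((c \o h2) j) (u2 _ c2) // (u2 _ (unordered_sum_expands s2)).
split; first split=> //.
  move=> [p q] _; have [a1 [a2 [s1 s2 uniq]]] := ex p q.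
  by exists (cc a1 a2); split=> //; exact/unordered_sum_expands/sum.
move=> [p q] c _ cpq pi pibij; have [a1 [a2 [s1 s2 /(_ _ cpq) cE]]] := ex p q.
have := unordered_sum_rearranged pibij (sum _ _ _ _ s1 s2).
by apply: eq_expands => i Di /=; rewrite cE //; case: pibij => + _ _; apply.
Qed.

Lemma initial_segment_inj m k : `I_m = `I_k -> m = k.
Proof. by move=> mk; apply/card_eq_II; rewrite mk card_eqxx. Qed.

Lemma initial_segment_neqT k : [set: nat] <> `I_k.
Proof. by move=> kT; have : `I_k k; [rewrite -kT|rewrite /= ltnn]. Qed.

(** The union of the two bases, enumerated alternately if both are infinite and
    starting with a finite one otherwise. *)
Theorem product_basis (D1 D2 : set nat) (u : nat -> V) (v : nat -> W) :
  index_set D1 -> index_set D2 ->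
  unconditional_basis [set: V] D1 u -> unconditional_basis [set: W] D2 v ->
  exists D b, [/\ index_set D, unconditional_basis [set: V * W] D b,
    (forall i, D i -> (exists2 j, D1 j & b i = (u j, 0)) \/
                      (exists2 j, D2 j & b i = (0, v j))) &
    forall k, D = `I_k ->
      exists k1 k2, [/\ D1 = `I_k1, D2 = `I_k2 & k = (k1 + k2)%N]].
Proof.
move=> iD1 iD2 ub vb.
(* It suffices to interleave the index sets. *)
suff [D [h1 [h2 [g [iD [h1m h2m] [g1 g2 gD] Dk]]]]] :
    exists D h1 h2 (g : nat -> nat + nat), [/\ index_set D,
    {mono h1 : i j / (i < j)%N} /\ {mono h2 : i j / (i < j)%N},
    [/\ (forall j, D1 j -> D (h1 j) /\ g (h1 j) = inl j),
      (forall j, D2 j -> D (h2 j) /\ g (h2 j) = inr j) &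
      (forall i, D i -> match g i with
                       | inl j => D1 j /\ i = h1 j
                       | inr j => D2 j /\ i = h2 j
                       end)] &
    forall k, D = `I_k ->
      exists k1 k2, [/\ D1 = `I_k1, D2 = `I_k2 & k = (k1 + k2)%N]].
  exists D; eexists; split; [exact: iD|
    exact: product_basis_embedded iD1 iD2 ub vb h1m h2m g1 g2 gD| |exact: Dk].
  move=> i /gD; case: (g i) => j [Dj _]; [left|right]; by exists j.
have addm k : {mono addn k : i j / (i < j)%N} by move=> i j; rewrite ltn_add2l.
case: iD1 {ub} => [->|[k1 ->]]; case: iD2 {vb} => [->|[k2 ->]].
- exists [set: nat], double, (fun j => j.*2.+1),
    (fun i => if odd i then inr i./2 else inl i./2).
  split; [by left| |split|by move=> k /initial_segment_neqT].
  + by split=> i j; rewrite ?ltnS ?ltn_double ?ltn_Sdouble.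
  + by move=> j _; rewrite odd_double doubleK.
  + by move=> j _; rewrite /= odd_double /= uphalf_double.
  + move=> i _; have := odd_double_half i.
    by case: (odd i) => h; split.
- exists [set: nat], (addn k2), id,
    (fun i => if (i < k2)%N then inr i else inl (i - k2)%N).
  split; [by left|by []|split|by move=> k /initial_segment_neqT].
  + by move=> j _; rewrite ltnNge leq_addr addKn.
  + by move=> j /= jk; rewrite jk.
  + by move=> i _; case: ltnP => // h; rewrite subnKC.
- exists [set: nat], id, (addn k1),
    (fun i => if (i < k1)%N then inl i else inr (i - k1)%N).
  split; [by left|by []|split|by move=> k /initial_segment_neqT].
  + by move=> j /= jk; rewrite jk.
  + by move=> j _; rewrite ltnNge leq_addr addKn.
  + by move=> i _; case: ltnP => // h; rewrite subnKC.
- exists `I_(k1 + k2), id, (addn k1),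
    (fun i => if (i < k1)%N then inl i else inr (i - k1)%N).
  split; [by right; exists (k1 + k2)%N|by []|split|].
  + by move=> j /= jk; rewrite jk ltn_addr.
  + by move=> j /= jk; rewrite ltn_add2l jk ltnNge leq_addr addKn.
  + by move=> i /= ik; case: ltnP => // h; rewrite /= subnKC // ltn_subLR.
  + by move=> k /initial_segment_inj <-; exists k1, k2.
Qed.

Lemma has_basis_prod : has_unconditional_basis [set: V] ->
  has_unconditional_basis [set: W] -> has_unconditional_basis [set: V * W].
Proof.
move=> [D1 [u [i1 ub]]] [D2 [v [i2 vb]]].
by have [D [b [iD bb _ _]]] := product_basis i1 i2 ub vb; exists D, b.
Qed.

End ProductBasis.

(** * The decomposition argument *)

Section Limits.
Context {K : numFieldType} {V : normedModType K}.
Implicit Types (u : nat -> V) (l : V).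

Lemma norm_lt_all_eq0 (v : V) : (forall e : K, 0 < e -> `|v| <= e) -> v = 0.
Proof.
move=> h; apply/eqP; rewrite -normr_le0; apply/ler_addgt0Pr => e /h.
by rewrite add0r.
Qed.

Lemma seq_cvg_unique u l l' : u @ \oo --> l -> u @ \oo --> l' -> l = l'.
Proof.
move=> ul ul'; apply/subr0_eq/norm_lt_all_eq0 => e e0.
have /cvg_epsP/(_ _ e0) [N hN] := ul'.
apply: (limit_norm_le (N := N) ul) => n Nn.
by rewrite distrC ltW // hN.
Qed.

Lemma seq_cvg_bounded u l : u @ \oo --> l -> exists C : K, forall n, `|u n| <= C.
Proof.
move=> /cvg_epsP/(_ 1 ltr01) [N hN].
exists (`|l| + 1 + \sum_(i < N) `|u i|) => n.
have S0 : 0 <= \sum_(i < N) `|u i| by apply: sumr_ge0.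
case: (ltnP n N) => [nN|Nn].
  rewrite (bigD1 (Ordinal nN)) //= addrCA lerDl addr_ge0 ?addr_ge0 //.
  exact: sumr_ge0.
rewrite -[leLHS]addr0 lerD // -{1}(subrK l (u n)) addrC.
by rewrite (le_trans (ler_normD _ _)) // lerD2l distrC ltW // hN.
Qed.

Lemma seq_cvg_shift u l : u @ \oo --> l -> (fun n => u n.+1) @ \oo --> l.
Proof.
move=> /cvg_epsP ul; apply/cvg_epsP => e /ul [N hN]; exists N => n Nn.
by apply: hN; exact: leqW.
Qed.

Lemma persistent_le (sel : nat -> nat -> bool) n m j :
  (forall n j, sel n j -> sel n.+1 j) -> (n <= m)%N -> sel n j -> sel m j.
Proof.
move=> selS /subnKC <- sn.
by elim: (m - n)%N => [|k IH]; rewrite ?addn0 // addnS selS.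
Qed.

Lemma stable_from (sel : nat -> nat -> bool) N :
  (forall n j, sel n j -> sel n.+1 j) ->
  exists M, forall j n, (j < N)%N -> sel n j -> sel M j.
Proof.
move=> selS; have sel_le n m j := @persistent_le sel n m j selS.
elim: N => [|N [M hM]]; first by exists 0%N.
have [[k sk]|nk] := pselect (exists k, sel k N); last first.
  exists M => j n; rewrite ltnS leq_eqVlt => /predU1P[->|]; last exact: hM.
  by move=> sn; case: nk; exists n.
exists (maxn M k) => j n; rewrite ltnS leq_eqVlt => /predU1P[-> _|jN /(hM _ _ jN)].
  by apply: sel_le sk; exact: leq_maxr.
by apply: sel_le; exact: leq_maxl.
Qed.

End Limits.

Section Decomposition.
Context {K : numFieldType} (arch : forall x : K, exists n, `|x| <= n%:R).
Context (Y : completeNormedModType K) (W Z : normedModType K).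
Context (T : Y * W * Z -> Y) (T' : Y -> Y * W * Z).
Context (Tb : bounded_op T) (T'b : bounded_op T').
Context (TK : cancel T T') (T'K : cancel T' T).

Let in1 (y : Y) := T (y, 0, 0).
Let pr1 (y : Y) := (T' y).1.1.
Let P0 (y : Y) := T (0, 0, (T' y).2).

(** The projection of [Y] onto the sum of the copies [in1 ^ k (T (0, 0, Z))] of
    [Z], for [k <= n]. *)
Fixpoint partial_proj n : Y -> Y :=
  if n is m.+1 then fun y => P0 y + in1 (partial_proj m (pr1 y)) else P0.

Local Notation P := partial_proj.

Let in1b : bounded_op in1.
Proof. exact: bop_comp Tb (bop_comp (bop_inl _ _) (bop_inl _ _)). Qed.

Let pr1b : bounded_op pr1.
Proof. exact: bop_comp (bop_comp (bop_fst _ _) (bop_fst _ _)) T'b. Qed.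

Let P0b : bounded_op P0.
Proof.
exact: bop_comp Tb (bop_comp (bop_inr _ _) (bop_comp (bop_snd _ _) T'b)).
Qed.

Lemma partial_proj_bounded n : bounded_op (P n).
Proof.
elim: n => [|n IH]; first exact: P0b.
exact: bop_add P0b (bop_comp in1b (bop_comp IH pr1b)).
Qed.

Let Pb := partial_proj_bounded.

Let P0_in1 y : P0 (in1 y) = 0. Proof. by rewrite /P0 /in1 TK (op0 Tb). Qed.
Let pr1_in1 y : pr1 (in1 y) = y. Proof. by rewrite /pr1 /in1 TK. Qed.
Let pr1_P0 y : pr1 (P0 y) = 0. Proof. by rewrite /pr1 /P0 TK. Qed.
Let P0_P0 y : P0 (P0 y) = P0 y. Proof. by rewrite {1}/P0 {1}/P0 TK. Qed.

Let PS n y : P n.+1 y = P0 y + in1 (P n (pr1 y)). Proof. by []. Qed.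

Let P0_P n y : P0 (P n y) = P0 y.
Proof.
case: n => [|n]; first exact: P0_P0.
by rewrite PS (opD P0b) P0_P0 P0_in1 addr0.
Qed.

Lemma partial_proj_comp n m y : (n <= m)%N -> P n (P m y) = P n y.
Proof.
elim: n m y => [|n IH] m y; first by move=> _; exact: P0_P.
case: m => // m nm; rewrite PS P0_P [in RHS]PS; congr (_ + in1 _).
by rewrite PS (opD pr1b) pr1_P0 pr1_in1 add0r IH.
Qed.

Context (D : set nat) (e : nat -> Y).
Context (e_sum : forall y, exists a, unordered_sum D a e y).
(* This is how the basis e ties in with T, scaling factors being allowed. *)
Context (e_split : forall j, D j ->
  [\/ exists i (c : K), D i /\ e j = T (c *: e i, 0, 0),
      exists w, e j = T (0, w, 0) |
      exists z, e j = T (0, 0, z)]).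

Let P_second n w : P n (T (0, w, 0)) = 0.
Proof.
have h : P0 (T (0, w, 0)) = 0 by rewrite /P0 TK (op0 Tb).
case: n => [|n]; first exact: h.
by rewrite PS h /pr1 TK (op0 (Pb n)) (op0 in1b) addr0.
Qed.

Let P_third n z : P n (T (0, 0, z)) = T (0, 0, z).
Proof.
have h : P0 (T (0, 0, z)) = T (0, 0, z) by rewrite /P0 TK.
case: n => [|n]; first exact: h.
by rewrite PS h /pr1 TK (op0 (Pb n)) (op0 in1b) addr0.
Qed.

Let P_first n c y : P n.+1 (T (c *: y, 0, 0)) = c *: in1 (P n y).
Proof. by rewrite PS P0_in1 pr1_in1 (opZ (Pb n)) (opZ in1b) add0r. Qed.

Let in1Z c y : T (c *: y, 0, 0) = c *: in1 y.
Proof. exact: (opZ in1b). Qed.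

Lemma partial_proj_basis n j : D j -> P n (e j) = 0 \/ P n (e j) = e j.
Proof.
elim: n j => [|n IH] j Dj; have [[i [c [Di ->]]]|[w ->]|[z ->]] := e_split Dj.
- by left; exact: P0_in1.
- by left; exact: P_second.
- by right; exact: P_third.
- rewrite P_first; have [->|->] := IH i Di; last by right.
  by left; rewrite (op0 in1b) scaler0.
- by left; exact: P_second.
- by right; exact: P_third.
Qed.

Lemma partial_proj_basisS n j : D j -> P n (e j) = e j -> P n.+1 (e j) = e j.
Proof.
elim: n j => [|n IH] j Dj.
  have [[i [c [Di ->]]]|[w ->]|[z ->]] := e_split Dj; rewrite ?P_third //.
    by rewrite [LHS]P0_in1 => <-; rewrite (op0 (Pb 1)).
  by rewrite P_second => <-; rewrite (op0 (Pb 1)).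
have [[i [c [Di ->]]]|[w ->]|[z ->]] := e_split Dj; rewrite ?P_third //.
  rewrite !P_first in1Z; have [h|h] := partial_proj_basis n Di.
    rewrite h (op0 in1b) scaler0 => h2; rewrite -h2 -(opZ in1b) -(opZ (Pb _)).
    have -> : c *: e i = 0 by rewrite -[LHS]pr1_in1 (opZ in1b) -h2 (op0 pr1b).
    by rewrite (op0 (Pb _)) (op0 in1b).
  by rewrite (IH _ Di h).
by rewrite !P_second.
Qed.

Let sel n j := `[< D j /\ P n (e j) = e j >].

Let selS n j : sel n j -> sel n.+1 j.
Proof.
by move=> /asboolP[Dj h]; apply/asboolP; split=> //; exact: partial_proj_basisS.
Qed.

Let P_sel n j : D j -> P n (e j) = if sel n j then e j else 0.
Proof.
move=> Dj; case: ifP => [/asboolP[] //|/negbT/asboolPn h].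
by have [//|h2] := partial_proj_basis n Dj; case: h; split.
Qed.

(** By [partial_proj_basis] and [partial_proj_basisS] the projections select more
    and more basis vectors, so two late ones differ by a sum of far away terms
    of the expansion of [y]. *)
Lemma partial_proj_cvg y : exists l : Y, P ^~ y @ \oo --> l.
Proof.
have [a ay] := e_sum y; apply: cauchy_seq_cvg => r r0.
have r2 : 0 < r / 2 by rewrite divr_gt0.
have [N hN] := unordered_sum_tail ay r2.
have [M hM] := stable_from N selS.
exists M => n Mn; have Qb := bop_add (Pb M) (bop_opp (Pb n)).
have [N' hN'] := op_unordered_sum Qb ay r2.
pose s := initial D N'; have us : uniq s by exact: initial_uniq.
have Ds i : i \in s -> D i by move=> /mem_initial[].
have h1 := hN' s us Ds (fun i iN Di => (mem_initial D N' i).2 (conj iN Di)).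
move: s us Ds h1 => s us Ds h1.
(* Beyond M, the projections differ only on basis vectors of index >= N. *)
pose s' := [seq i <- s | sel n i && ~~ sel M i].
have h2 : `|\sum_(i <- s') a i *: e i| < r / 2.
  apply: hN; first by rewrite filter_uniq.
  move=> i; rewrite mem_filter => /andP[/andP[ni Mi] /Ds Di]; split=> //.
  by rewrite leqNgt; apply: contra Mi => iN; exact: hM iN ni.
have h3 : \sum_(i <- s) a i *: (P M (e i) - P n (e i)) =
    - \sum_(i <- s') a i *: e i.
  rewrite big_filter [in RHS]big_mkcond -sumrN; apply: eq_big_seq => i /Ds Di.
  rewrite !P_sel //; have := @persistent_le sel M n i selS Mn.
  case: (sel M i); case: (sel n i) => /=; rewrite ?subrr ?scaler0 ?oppr0 //.
    by move=> /(_ isT).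
  by rewrite sub0r scalerN.
rewrite (splitr r); apply: le_lt_trans (ltrD h1 h2).
rewrite -[X in _ <= _ + X]normrN -h3 /=.
set A := \sum_(i <- s) _; set B := P M y - P n y.
by rewrite -{1}(subrK A B); exact: ler_normD.
Qed.

(** The limit [L] of the partial projections projects onto the sum of all the
    copies of [Z].  On the range of [L] the isomorphism applies [in1], which moves
    each copy of [Z] to the next one and so frees the first; on the kernel of [L]
    it is the identity. *)
Theorem decomposition : isomorphic Y (Y * W)%type.
Proof.
have /choice [L PL] := partial_proj_cvg.
have Lb : bounded_op L.
  split=> [c u v|].
    apply: seq_cvg_unique (PL _) _.
    under eq_fun do rewrite (Pb _).1.
    exact: cvgD (cvgZ (cvg_cst c) (PL u)) (PL v).
  have [C hC] := uniform_boundedness arch Pb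
    (fun v => seq_cvg_bounded (PL v)).
  exists C => v; rewrite -[L v]subr0.
  by apply: (limit_norm_le (N := 0%N) (PL v)) => n _; rewrite subr0.
have LE y : L y = P0 y + in1 (L (pr1 y)).
  apply: seq_cvg_unique (seq_cvg_shift (PL y)) _.
  exact: cvgD (cvg_cst _) (op_cvg in1b (PL (pr1 y))).
(* L is idempotent since P n \o P m = P n for n <= m: let m, then n, grow. *)
have PnL n y : P n (L y) = P n y.
  apply: seq_cvg_unique (op_cvg (Pb n) (PL y)) _.
  apply/cvg_epsP => r r0; exists n => m nm /=.
  by rewrite partial_proj_comp // subrr normr0.
have LL y : L (L y) = L y.
  apply: seq_cvg_unique (PL _) _; have := PL y.
  by under eq_fun do rewrite -PnL.
have L_in1 y : L (in1 y) = in1 (L y) by rewrite LE P0_in1 pr1_in1 add0r.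
have L_second w : L (T (0, w, 0)) = 0.
  by rewrite LE /P0 /pr1 !TK (op0 Tb) (op0 Lb) (op0 in1b) addr0.
have L_T y w : L (T (y, w, 0)) = in1 (L y).
  rewrite -L_in1 -[RHS]addr0 -(L_second w) -(opD Lb) -(opD Tb).
  by congr (L (T _)); congr (_, _, _) => /=; rewrite ?addr0 ?add0r.
have in1_inj : injective in1 by exact: can_inj pr1_in1.
apply/isomorphicP.
exists (fun y => (T' (in1 (L y) + (y - L y))).1),
  (fun p => L p.1 + (T (p, 0) - L (T (p, 0)))).
split.
- apply: bop_comp (bop_fst _ _) (bop_comp T'b _).
  apply: bop_add (bop_comp in1b Lb) (bop_add (bop_id _) (bop_opp Lb)).
- have hT := bop_comp Tb (bop_inl (Y * W)%type Z).
  exact: bop_add (bop_comp Lb (bop_fst _ _)) (bop_add hT (bop_opp (bop_comp Lb hT))).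
- move=> y; set q := in1 _ + _.
  (* q has no component in the first copy of Z. *)
  have q2 : (T' q).2 = 0.
    have h z : (T' z).2 = (T' (P0 z)).2 by rewrite /P0 TK.
    have P0L : P0 (L y) = P0 y by rewrite LE (opD P0b) P0_in1 addr0 P0_P0.
    suff P0q : P0 q = 0 by rewrite h P0q (op0 T'b).
    by rewrite /q (opD P0b) P0_in1 add0r (opB P0b) P0L subrr.
  have Tq : T ((T' q).1, 0) = q by rewrite -q2 -surjective_pairing T'K.
  rewrite Tq; case E : (T' q).1 => [y1 w] /=; rewrite E in Tq.
  have Lq : L q = in1 (L y).
    by rewrite /q (opD Lb) L_in1 LL (opB Lb) LL subrr addr0.
  have -> : L y1 = L y by apply: in1_inj; rewrite -(L_T y1 w) Tq Lq.
  by rewrite Lq /q addrAC subrr add0r addrC subrK.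
- move=> [y w] /=; rewrite L_T; set q := T _.
  have -> : L (L y + (q - in1 (L y))) = L y.
    by rewrite (opD Lb) LL (opB Lb) L_in1 LL L_T subrr addr0.
  by rewrite [X in X - L y]addrC addrK addrC subrK TK.
Qed.

End Decomposition.

(** * Uniqueness of bases in complemented subspaces *)

Section Closures.
Context {K : numFieldType}.
Implicit Types V W : normedModType K.

Lemma closure_epsP V (A : set V) v : closure A v <->
  forall e : K, 0 < e -> exists2 w, A w & `|v - w| < e.
Proof.
split=> [cv e e0|h B /nbhs_ballP [e e0 eB]].
  by have [w [Aw]] := cv _ (nbhsx_ballx v e e0); rewrite -ball_normE; exists w.
by have [w Aw vw] := h e e0; exists w; split=> //; apply: eB; rewrite -ball_normE.
Qed.

Lemma op_continuous V W (f : V -> W) : bounded_op f -> continuous f.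
Proof.
move=> fb v; have [C [C0 hC]] := op_bound fb.
apply/cvgrPdist_lt => e e0; apply/nbhs_ballP; exists (e / C).
  by rewrite /= divr_gt0.
move=> w; rewrite -ball_normE /= => vw; rewrite -(opB fb).
by rewrite (le_lt_trans (hC _)) // mulrC -ltr_pdivlMr.
Qed.

Lemma range_closed V W (J : V -> W) (R : W -> V) : bounded_op J ->
  bounded_op R -> cancel J R -> closure (range J) `<=` range J.
Proof.
move=> Jb Rb JK w /closure_epsP cw; exists (R w) => //.
have Qb := bop_add (bop_comp Jb Rb) (bop_opp (bop_id W)).
have [C [C0 hC]] := op_bound Qb.
apply/subr0_eq/norm_lt_all_eq0 => e e0.
have [_ [v _ <-] hv] := cw (e / C) (divr_gt0 e0 C0).
have := hC (w - J v); rewrite (opB Qb) /= JK subrr subr0 => /le_trans; apply.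
by rewrite mulrC -ler_pdivlMr // ltW.
Qed.

Lemma closed_span_range V W (J : V -> W) (R : W -> V) D (x : nat -> W) :
  bounded_op J -> bounded_op R -> cancel J R ->
  (forall i, D i -> range J (x i)) ->
  (forall w, range J w -> exists a, expands D x a w) ->
  closed_span D x = range J.
Proof.
move=> Jb Rb JK Jx xe; apply/seteqP; split.
  apply: subset_trans (range_closed Jb Rb JK); apply: closureS.
  move=> _ [m [a ->]]; rewrite partial_sumE.
  exists (\sum_(i <- initial D m) a i *: R (x i)) => //.
  rewrite (op_sum Jb); apply: eq_big_seq => i /mem_initial[_ /Jx [v _ <-]].
  by rewrite (opZ Jb) JK.
move=> w /xe [a /cvg_epsP aw]; apply/closure_epsP => e /aw [N hN].
by exists (partial_sum D a x N); [exists N, a|exact: hN].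
Qed.

Lemma retraction_isomorphism V W (J : V -> W) (R : W -> V) : bounded_op J ->
  bounded_op R -> cancel J R -> isomorphism_on [set: V] (range J) J.
Proof.
move=> Jb Rb JK; split.
- by move=> a u v _ _; exact: Jb.1.
- by split; [move=> y _; exists y|move=> u v _ _; exact: (can_inj JK)|].
- by have [_ [C hC]] := Jb; exists C.
- by have [_ [C hC]] := Rb; exists C => v _; rewrite -{1}(JK v).
Qed.

Lemma retraction_complemented (Y : normedModType K) (X : completeNormedModType K)
    (J : Y -> X) (R : X -> Y) :
  bounded_op J -> bounded_op R -> cancel J R -> complemented_subspace (range J).
Proof.
move=> Jb Rb JK; have Pb := bop_comp Jb Rb.
pose lin := GRing.isLinear.Build K X X *:%R (J \o R) Pb.1.
pose P : {linear X -> X} := HB.pack (J \o R) lin.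
exists P; split.
- exact: op_continuous Pb.
- by move=> v /=; rewrite JK.
- apply/seteqP; split=> [_ [v _ <-]|_ [y _ <-]]; first by exists (R v).
  by exists (J y) => //=; rewrite JK.
Qed.

Lemma index_set_bij_eq D D' (p : nat -> nat) :
  index_set D -> index_set D' -> set_bij D D' p -> D = D'.
Proof.
move=> iD iD' pbij; have cDD' : (D #= D')%card by apply/card_set_bijP; exists p.
have inf k : ~ ([set: nat] #= `I_k)%card.
  by move=> c; apply: infinite_nat; exists k.
case: iD iD' cDD' => [->|[k ->]] [->|[l ->]] //.
- by move=> /inf.
- by rewrite card_eq_sym => /inf.
- by move=> /card_eq_II ->.
Qed.

End Closures.

Section Uniqueness.
Context {K : numFieldType} (arch : forall x : K, exists n, `|x| <= n%:R).
Context (X : completeNormedModType K).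
Context (X_unique : forall S : set X, complemented_subspace S ->
  has_unconditional_basis S -> unique_normalized_unconditional_basis S).

Definition retract_of_X (Y : normedModType K) : Prop :=
  exists (J : Y -> X) (R : X -> Y), [/\ bounded_op J, bounded_op R & cancel J R].

Lemma retract_factor (Y Y1 Y2 : normedModType K) : retract_of_X Y ->
  isomorphic Y (Y1 * Y2)%type -> retract_of_X Y1.
Proof.
move=> [J [R [Jb Rb JK]]] /isomorphicP[f [g [fb gb fg gf]]].
exists (fun y => J (g (y, 0))), (fun v => (f (R v)).1); split.
- exact: bop_comp Jb (bop_comp gb (bop_inl _ _)).
- exact: bop_comp (bop_fst _ _) (bop_comp fb Rb).
- by move=> y; rewrite JK gf.
Qed.

(** The hypothesis on [X] compares normalized bases of one and the same subspace,
    here the range of [J]; the bases [b] and [b'] have to be normalized in [X]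
    first, whence the factors [c i].  Keeping them avoids comparing [b] with its
    normalization, which would require bounded multipliers. *)
Lemma bases_equivalent (Y : normedModType K) D D' (b b' : nat -> Y) :
  retract_of_X Y -> index_set D -> index_set D' ->
  unconditional_basis [set: Y] D b -> unconditional_basis [set: Y] D' b' ->
  D = D' /\ exists (p : nat -> nat) (c : nat -> K) (T T' : Y -> Y),
    [/\ set_bij D D' p, forall i, D i -> c i != 0 &
    [/\ bounded_op T, bounded_op T', cancel T T', cancel T' T &
        forall i, D i -> T (b i) = c i *: b' (p i)]].
Proof.
move=> [J [R [Jb Rb JK]]] iD iD' bb b'b.
have cS := retraction_complemented Jb Rb JK.
have Jinj := can_inj JK.
pose nrm (y : nat -> Y) i : K := `|J (y i)|^-1.
have nrm0 E y i : unconditional_basis [set: Y] E y -> E i -> nrm y i != 0.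
  move=> yb Ei; rewrite invr_eq0 normr_eq0.
  by apply: contra (basis_neq0 yb Ei); rewrite -(op0 Jb) => /eqP/Jinj/eqP.
have normalized E y : index_set E -> unconditional_basis [set: Y] E y ->
    normalized_unconditional_basis (range J) E (fun i => nrm y i *: (J \o y) i).
  move=> iE yb; split=> //; last first.
    move=> i Ei; rewrite normrZ normfV normr_id mulVf // -invr_eq0.
    exact: nrm0 yb Ei.
  apply: scaled_basis; last exact: retraction_basis Jb Rb JK yb.
    by move=> i; exact: nrm0.
  by move=> i _; exists (nrm y i *: y i); rewrite ?(opZ Jb).
have xb := normalized D b iD bb; have x'b := normalized D' b' iD' b'b.
have hS : has_unconditional_basis (range J).
  by have [_ xb' _] := xb; exists D, (fun i => nrm b i *: (J \o b) i).
have [_ /(_ _ _ _ _ xb x'b)[p [pbij [T0 [T0i T0x]]]]] := X_unique cS hS.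
split; first exact: index_set_bij_eq pbij.
have xS E y i : E i -> range J (nrm y i *: (J \o y) i).
  by move=> _; exists (nrm y i *: y i); rewrite ?(opZ Jb).
have eD : closed_span D (fun i => nrm b i *: (J \o b) i) = range J.
  apply: (closed_span_range Jb Rb JK) => [i|w Sw]; first exact: xS.
  have [_ xb' _] := xb; have [a aw] := basis_unordered_sum iD xb' Sw.
  by exists a; exact: unordered_sum_expands aw.
have eD' : closed_span D ((fun i => nrm b' i *: (J \o b') i) \o p) = range J.
  apply: (closed_span_range Jb Rb JK) => [i Di|w Sw].
    by apply: (xS D'); case: pbij => pD _ _; exact: pD.
  have [_ xb' _] := x'b; have [a aw] := basis_unordered_sum iD' xb' Sw.
  by exists (a \o p); exact: unordered_sum_rearranged pbij aw.
rewrite eD eD' in T0i.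
have Ji := retraction_isomorphism Jb Rb JK.
have Ri : isomorphism_on (range J) [set: Y] R.
  split.
  - by move=> a u v _ _; exact: Rb.1.
  - split=> //; last by move=> y _; exists (J y) => //; exists y.
    move=> u v; rewrite !inE => -[u' _ <-] [v' _ <-]; by rewrite !JK => ->.
  - by have [_ [C hC]] := Rb; exists C.
  - have [_ [C hC]] := Jb; exists C => _ [v _ <-]; by rewrite JK; exact: hC.
have T0Z a u : range J u -> T0 (a *: u) = a *: T0 u.
  have J0 : range J 0 by exists 0; rewrite ?(op0 Jb).
  have [lin _ _ _] := T0i => Ju.
  have T00 : T0 0 = 0.
    apply: (@addIr _ (T0 0)); rewrite add0r.
    by have := lin 1 0 0 J0 J0; rewrite !scale1r addr0.
  by have := lin a u 0 Ju J0; rewrite T00 !addr0.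
have Ti : isomorphism_on [set: Y] [set: Y] (R \o (T0 \o J)).
  exact: isomorphism_on_comp (isomorphism_on_comp Ji T0i) Ri.
have [T' [Tb T'b TT' T'T]] := isomorphism_onT Ti.
exists p, (fun i => (nrm b i)^-1 * nrm b' (p i)), (R \o (T0 \o J)), T'.
have pD : forall i, D i -> D' (p i) by case: pbij.
split=> // [i Di|].
  have n1 := nrm0 D b i bb Di; have n2 := nrm0 D' b' (p i) b'b (pD i Di).
  by apply: mulf_neq0 => //; rewrite invr_eq0.
split=> // i Di /=.
have -> : J (b i) = (nrm b i)^-1 *: (nrm b i *: J (b i)).
  by rewrite scalerA mulVf ?scale1r // (nrm0 D b i bb Di).
rewrite T0Z; last exact: (xS D b).
by rewrite T0x //= (opZ Rb) (opZ Rb) JK scalerA.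
Qed.

(** Compares [b] with the union of the bases [u] and [v], carried over to [Y]. *)
Lemma split_basis (Y Y1 Y2 : normedModType K) D D1 D2 (b : nat -> Y)
    (u : nat -> Y1) (v : nat -> Y2) :
  retract_of_X Y -> isomorphic Y (Y1 * Y2)%type ->
  index_set D -> index_set D1 -> index_set D2 ->
  unconditional_basis [set: Y] D b -> unconditional_basis [set: Y1] D1 u ->
  unconditional_basis [set: Y2] D2 v ->
  (forall k, D = `I_k ->
      exists k1 k2, [/\ D1 = `I_k1, D2 = `I_k2 & k = (k1 + k2)%N]) /\
  exists (T : Y1 * Y2 -> Y) (T' : Y -> Y1 * Y2),
    [/\ bounded_op T, bounded_op T', cancel T T', cancel T' T &
    forall j, D j ->
      (exists i c, D1 i /\ b j = T (c *: u i, 0)) \/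
      (exists i c, D2 i /\ b j = T (0, c *: v i))].
Proof.
move=> rY /isomorphicP[f [g [fb gb fg gf]]] iD iD1 iD2 bb ub vb.
have [D0 [w [iD0 wb wE D0k]]] := product_basis iD1 iD2 ub vb.
have gwb : unconditional_basis [set: Y] D0 (g \o w).
  suff <- : range g = [set: Y] by exact: retraction_basis gb fb gf wb.
  by apply/seteqP; split=> // y _; exists (f y).
have [DD [p [c [T [T' [[_ _ psurj] c0 [Tb T'b TK T'K TE]]]]]]] :=
  bases_equivalent rY iD0 iD gwb bb.
split; first by rewrite -DD.
exists (T \o g), (f \o T'); split.
- exact: bop_comp.
- exact: bop_comp.
- exact: can_comp.
- exact: can_comp.
have Tgb := bop_comp Tb gb.
move=> j /psurj [i Di <-].
have -> : b (p i) = (T \o g) ((c i)^-1 *: w i).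
  by rewrite (opZ Tgb) [X in _ *: X]TE // scalerA mulVf ?scale1r // c0.
have [[k Dk ->]|[k Dk ->]] := wE _ Di; [left|right]; exists k, (c i)^-1.
  by split=> //; congr ((T \o g) (_, _)); rewrite /= scaler0.
by split=> //; congr ((T \o g) (_, _)); rewrite /= scaler0.
Qed.

(** Cantor-Bernstein: [Y * W] lies between [Y] and [Y * W * Z ~ Y].  The three
    parts of the product occupy disjoint parts of the basis [e] of [Y], as
    [decomposition] requires. *)
Theorem absorption (Y : completeNormedModType K) (W Z : normedModType K) :
  retract_of_X Y -> has_unconditional_basis [set: Y] ->
  has_unconditional_basis [set: W] -> has_unconditional_basis [set: Z] ->
  isomorphic Y (Y * W * Z)%type -> isomorphic Y (Y * W)%type.
Proof.
move=> rY [D [e [iD eb]]] [DW [w [iW wb]]] [DZ [z [iZ zb]]] YYWZ.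
have [D1 [u [iD1 ub uE _]]] := product_basis iD iW eb wb.
have [_ [T [T' [Tb T'b TK T'K TE]]]] := split_basis rY YYWZ iD iD1 iZ eb ub zb.
apply: (decomposition arch Tb T'b TK T'K (D := D) (e := e)).
  by move=> y; exact: basis_unordered_sum iD eb I.
move=> j Dj; have [[i [c [/uE ui ->]]]|[i [c [_ ->]]]] := TE j Dj.
  have [[k Dk ->]|[k Dk ->]] := ui.
    apply: Or31; exists k, c; split=> //.
    by congr (T (_, _, _)); rewrite /= scaler0.
  apply: Or32; exists (c *: w k).
  by congr (T (_, _, _)); rewrite /= scaler0.
by apply: Or33; exists (c *: z i).
Qed.

End Uniqueness.

(** * Sums of unconditionally primary spaces *)

Section Decomposable.
Context {K : numFieldType}.
Implicit Types A B : nat -> completeNormedModType K.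

Definition decomposable (Y : normedModType K) : Prop :=
  exists (m : nat) (A : nat -> completeNormedModType K),
    isomorphic Y (direct_sum A m) /\
    forall i, (i <= m)%N -> unconditionally_primary (A i).

Lemma eq_isomorphic (V W : completeNormedModType K) : V = W -> isomorphic V W.
Proof. by move=> ->; exact: isomorphic_refl. Qed.

Lemma eq_direct_sum A B m : (forall i, (i <= m)%N -> A i = B i) ->
  isomorphic (direct_sum A m) (direct_sum B m).
Proof.
elim: m => [|m IH] AB; first exact/eq_isomorphic/AB.
apply: isomorphic_prod; last exact/eq_isomorphic/AB.
by apply: IH => i im; apply: AB; exact: leqW.
Qed.

Definition concat A B m i := if (i <= m)%N then A i else B (i - m.+1)%N.

Lemma direct_sum_concat A B m k :
  isomorphic (direct_sum A m * direct_sum B k)%type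
             (direct_sum (concat A B m) (m + k.+1)).
Proof.
have concatB j : concat A B m (m + j.+1) = B j.
  by rewrite /concat leqNgt addnS ltnS leq_addr /= subSS addKn.
have concatA i : (i <= m)%N -> A i = concat A B m i by rewrite /concat => ->.
elim: k => [|k IH]; rewrite addnS /=.
  rewrite addn0; apply: isomorphic_prod; first exact: eq_direct_sum.
  by apply: eq_isomorphic; rewrite -addn1 concatB.
apply: isomorphic_trans (isomorphic_sym (isomorphic_prodA _ _ _)) _.
by apply: isomorphic_prod => //; apply: eq_isomorphic; rewrite -addnS concatB.
Qed.

Lemma decomposable_prod (Y Y1 Y2 : normedModType K) :
  isomorphic Y (Y1 * Y2)%type -> decomposable Y1 -> decomposable Y2 ->
  decomposable Y.
Proof.
move=> YY [m [A [Y1A pA]]] [k [B [Y2B pB]]].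
exists (m + k.+1)%N, (concat A B m); split.
  apply: isomorphic_trans YY _.
  apply: isomorphic_trans (isomorphic_prod Y1A Y2B) _.
  exact: direct_sum_concat.
move=> i; rewrite /concat; case: (leqP i m) => [im _|mi ik]; first exact: pA.
by apply: pB; rewrite leq_subLR addSnnS.
Qed.

Lemma primary_decomposable (Y : completeNormedModType K) :
  unconditionally_primary Y -> decomposable Y.
Proof.
by move=> pY; exists 0%N, (fun=> Y); split=> //; exact: isomorphic_refl.
Qed.

Lemma not_primary (Y : completeNormedModType K) : ~ unconditionally_primary Y ->
  exists Y1 Y2 : completeNormedModType K,
    [/\ isomorphic Y (Y1 * Y2)%type, has_unconditional_basis [set: Y1],
      has_unconditional_basis [set: Y2], ~ isomorphic Y Y1 & ~ isomorphic Y Y2].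
Proof.
move=> npY; apply: contrapT => h; apply: npY => Y1 Y2 YY b1 b2.
apply: contrapT => /not_orP[n1 n2]; apply: h.
by exists Y1, Y2; split.
Qed.

End Decomposable.

(** * Spaces of finite genus *)

Section Genus.
Context {K : numFieldType} (arch : forall x : K, exists n, `|x| <= n%:R).
Context (X : completeNormedModType K).
Context (X_unique : forall S : set X, complemented_subspace S ->
  has_unconditional_basis S -> unique_normalized_unconditional_basis S).

Lemma retract_factors (Y Y1 Y2 : normedModType K) : retract_of_X X Y ->
  isomorphic Y (Y1 * Y2)%type -> retract_of_X X Y1 /\ retract_of_X X Y2.
Proof.
move=> rY YY; split; apply: (retract_factor rY); first exact: YY.
exact: isomorphic_trans YY (isomorphic_prodC _ _).
Qed.

(** If [Y] splits without being isomorphic to a factor, both factors are nonzero,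
    so each has a shorter basis than [Y]. *)
Lemma finite_decomposable k (Y : completeNormedModType K) (b : nat -> Y) :
  retract_of_X X Y -> unconditional_basis [set: Y] `I_k b -> decomposable Y.
Proof.
elim/ltn_ind: k => k IH in Y b * => rY bb.
have [/primary_decomposable //|/not_primary] := pselect (unconditionally_primary Y).
move=> [Y1 [Y2 [YY [D1 [u [iD1 ub]]] [D2 [v [iD2 vb]]] n1 n2]]].
have iDk : index_set `I_k by right; exists k.
have [/(_ k erefl) [k1 [k2 [E1 E2 kE]]] _] :=
  split_basis X_unique rY YY iDk iD1 iD2 bb ub vb.
rewrite {}E1 {D1 iD1} in ub; rewrite {}E2 {D2 iD2} in vb.
have [r1 r2] := retract_factors rY YY.
have k10 : (0 < k1)%N.
  case: k1 ub {kE} => // ub; case: n2.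
  apply: isomorphic_trans YY _; apply: isomorphic_trans (isomorphic_prodC _ _) _.
  exact: isomorphic_prod0 (basis_I0 ub).
have k20 : (0 < k2)%N.
  case: k2 vb {kE} => // vb; case: n1.
  exact: isomorphic_trans YY (isomorphic_prod0 _ (basis_I0 vb)).
apply: decomposable_prod YY _ _.
  by apply: IH r1 ub; rewrite kE -[ltnLHS]addn0 ltn_add2l.
by apply: IH r2 vb; rewrite kE -[ltnLHS]add0n ltn_add2r.
Qed.

Context (n : nat) (S_ : 'I_n -> set X).
Context (S_all : forall S : set X, complemented_subspace S ->
  has_unconditional_basis S -> ~ finite_dimensional S ->
  exists i, isomorphic_on S (S_ i)).

(** The [i]-th class contains [Y] or a summand of [Y].  The first case corresponds
    to the complement [W = 0]. *)
Definition below (i : 'I_n) (Y : normedModType K) : Prop :=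
  isomorphic_on [set: Y] (S_ i) \/
  exists Z W : normedModType K,
    [/\ has_unconditional_basis [set: Z], has_unconditional_basis [set: W],
      isomorphic Y (Z * W)%type & isomorphic_on [set: Z] (S_ i)].

Definition classes_below (Y : normedModType K) : {set 'I_n} :=
  [set i | `[< below i Y >]]%SET.

Lemma classes_belowP i Y : reflect (below i Y) (i \in classes_below Y).
Proof. by rewrite finset.in_set; exact: asboolP. Qed.

Lemma infinite_isomorphic_class (Y : normedModType K) (b : nat -> Y) :
  retract_of_X X Y -> unconditional_basis [set: Y] [set: nat] b ->
  exists i, isomorphic_on [set: Y] (S_ i).
Proof.
move=> [J [R [Jb Rb JK]]] bb.
have Jbb := retraction_basis Jb Rb JK bb.
have hS : has_unconditional_basis (range J).
  by exists [set: nat], (J \o b); split=> //; left.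
have [i Si] := S_all (retraction_complemented Jb Rb JK) hS
  (infinite_basis_not_finite_dimensional Jbb).
exists i; apply: isomorphic_on_trans Si; exists J.
exact: retraction_isomorphism Jb Rb JK.
Qed.

(** A class below [Y1] is below [Y], but the class of [Y] is not below [Y1]:
    otherwise [Y1 ~ Y * W], and by [absorption] this is isomorphic to [Y]. *)
Lemma card_classes_below_factor (Y : completeNormedModType K)
    (Y1 Y2 : normedModType K) (b : nat -> Y) :
  retract_of_X X Y -> unconditional_basis [set: Y] [set: nat] b ->
  isomorphic Y (Y1 * Y2)%type -> has_unconditional_basis [set: Y1] ->
  has_unconditional_basis [set: Y2] -> ~ isomorphic Y Y1 ->
  (#|classes_below Y1| < #|classes_below Y|)%N.
Proof.
move=> rY bb YY b1 b2 n1; apply: proper_card; apply/properP; split.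
  apply/fintype.subsetP => i /classes_belowP bi; apply/classes_belowP; right.
  case: bi => [Si|[Z [W [Zb Wb Y1E Si]]]]; first by exists Y1, Y2.
  exists Z, (W * Y2)%type; split=> //; first exact: has_basis_prod.
  apply: isomorphic_trans YY _; apply: isomorphic_trans _ (isomorphic_prodA _ _ _).
  by apply: isomorphic_prod => //; exact: isomorphic_refl.
have [i Si] := infinite_isomorphic_class rY bb.
exists i; first by apply/classes_belowP; left.
apply/classes_belowP => -[Si1|[Z [W [Zb Wb Y1E SiZ]]]].
  by apply: n1; exact: isomorphic_common_image Si Si1.
have ZY := isomorphic_common_image SiZ Si.
have Y1YW : isomorphic Y1 (Y * W)%type.
  by apply: isomorphic_trans Y1E _; apply: isomorphic_prod ZY (isomorphic_refl _).
have hY : has_unconditional_basis [set: Y].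
  by exists [set: nat], b; split=> //; left.
apply: n1; apply: isomorphic_trans _ (isomorphic_sym Y1YW).
apply: (absorption arch X_unique rY hY Wb b2).
by apply: isomorphic_trans YY _; apply: isomorphic_prod Y1YW (isomorphic_refl _).
Qed.

Theorem retract_decomposable (Y : completeNormedModType K) :
  retract_of_X X Y -> has_unconditional_basis [set: Y] -> decomposable Y.
Proof.
have [k] := ubnP #|classes_below Y|.
elim: k => // k IH in Y *; rewrite ltnS => hk rY.
move=> [D [b [[->|[l ->]] bb]]]; last exact: finite_decomposable rY bb.
have [/primary_decomposable //|/not_primary] := pselect (unconditionally_primary Y).
move=> [Y1 [Y2 [YY b1 b2 n1 n2]]]; have [r1 r2] := retract_factors rY YY.
have YY' := isomorphic_trans YY (isomorphic_prodC _ _).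
apply: (decomposable_prod YY); apply: IH => //; apply: leq_trans hk.
  exact: card_classes_below_factor rY bb YY b1 b2 n1.
exact: card_classes_below_factor rY bb YY' b2 b1 n2.
Qed.

End Genus.

Lemma genus_decomposable (K : numFieldType) (n : nat)
    (X : completeNormedModType K) :
  (forall x : K, exists n, `|x| <= n%:R) -> genus n X -> decomposable X.
Proof.
move=> arch [[[D [x [iD xb _]]] _] X_unique [S_ [_ _ S_all]]].
apply: (retract_decomposable arch X_unique S_all); last by exists D, x.
by exists id, id; split=> //; exact: bop_id.
Qed.

Lemma scalar_field_archimedean (R : realType) (s : scalars)
    (x : scalar_field R s) :
  exists n, `|x| <= n%:R.
Proof.
case: s x => /= [x|x].
  by exists (Num.bound `|x|); rewrite ltW // archi_boundP.
rewrite normc_def; set r := Num.sqrt _; exists (Num.bound r).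
rewrite -(rmorph_nat (real_complex R)) lecR ltW //.
by rewrite archi_boundP // sqrtr_ge0.
Qed.

Theorem theorem2p5 (R : realType) (s : scalars) (n : nat) (hn : (0 < n)%N)
    (X : completeNormedModType (scalar_field R s)) (hX : genus n X) :
  exists (m : nat) (X_ : nat -> completeNormedModType (scalar_field R s)),
    (0 < m)%N /\
    isomorphic X (direct_sum X_ m.-1) /\
    (forall i : nat, (i < m)%N -> unconditionally_primary (X_ i)).
Proof.
have [m [A [XA pA]]] := genus_decomposable (@scalar_field_archimedean R s) hX.
by exists m.+1, A.
Qed.
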